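(* Let $k,l\ge1$ be integers, $n=k+l$, let $J=\mathrm{diag}(J_1,\dots,J_n)$ be a real diagonal matrix with all $J_i\neq0$ and $J_i^2\ne J_j^2$ for $i\neq j$, and let $\kappa>0$. Then the Heisenberg model on the light-like cone in the pseudo-Euclidean space $E^{k,l}$, i.e. the map $\Phi$ defined in the context restricted to $M_\kappa$, is a completely integrable contact system on the $(2n-3)$-dimensional contact manifold $(M_\kappa,\alpha)$.
   Context: Pseudo-Euclidean space: $E^{k,l}$ is $\mathbb R^n$ with scalar product $\langle x,y\rangle=\sum_{i=1}^n\tau_ix_iy_i$, where $\tau_1=\dots=\tau_k=1$, $\tau_{k+1}=\dots=\tau_n=-1$. Light-like cone and phase space: $S_0^{n-1}=\{q\in\mathbb R^n:\langle q,q\rangle=0\}$, $P_0=S_0^{n-1}\times S_0^{n-1}$ with points $(q,Q)$, and $P_0^*=\{(q,Q)\in P_0:\langle q,J^{-1}Q\rangle\ne0\}$, a smooth manifold of dimension $2n-2$. Heisenberg map: for $(q,Q)\in P_0$ with $\langle J^{-2}Q,Q\rangle\neq0$, $$\Phi(q,Q)=\bigl(Q,\ \lambda J^{-1}Q-q\bigr),\qquad \lambda=\frac{2\langle J^{-1}Q,q\rangle}{\langle J^{-2}Q,Q\rangle}.$$ $\Phi$ is only defined outside the singular set $\{\langle J^{-2}Q,Q\rangle=0\}$; statements about $\Phi$ are understood on its domain of definition. Contact manifold: $M_\kappa=\{(q,Q)\in P_0^*:\langle q,JQ\rangle=\pm\kappa\}$, with the contact form given by the restriction of $\alpha=\sum_i\tau_iJ_iQ_i\,dq_i$.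 Where defined, $\Phi$ maps $M_\kappa$ to itself. Contact notions: for a contact manifold $(M,\alpha)$, the Reeb vector field $Z$ is determined by $i_Z\alpha=1$, $i_Zd\alpha=0$. A vector field $Y$ is contact if $\mathcal L_Y\alpha=\rho\,\alpha$ for some smooth function $\rho$. The map $Y\mapsto i_Y\alpha$ is a bijection from contact vector fields to smooth functions; $Y_f$ denotes the contact vector field with $i_{Y_f}\alpha=f$ (so $Y_1=Z$). The Jacobi bracket is $[f,g]=\mathcal L_{Y_f}g-g\,\mathcal L_Zf$, and $Y_{[f,g]}=[Y_f,Y_g]$. Complete contact integrability: a map $\Phi$ on a contact manifold $(M,\alpha)$ of dimension $2m+1$ (here $m=n-2$) is a completely integrable contact system if $\Phi^*\alpha=\alpha$ and there exist $m$ smooth functions $g_1,\dots,g_m$ on $M$ that are integrals of $\Phi$ ($g_i\circ\Phi=g_i$ on the domain of $\Phi$), are invariant under the Reeb flow ($\mathcal L_Zg_i=0$, equivalently $[Z,Y_{g_i}]=0$), commute with respect to the Jacobi bracket ($[g_i,g_j]=0$, equivalently $[Y_{g_i},Y_{g_j}]=0$), and are functionally independent (have linearly independent differentials) on an open dense subset of $M$. *)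

(* Defs.v *)
(* MathComp-Analysis, over an arbitrary [R : realType]. *)
From HB Require Import structures.
From mathcomp Require Import all_boot all_order all_algebra.
From mathcomp Require Import all_classical all_reals all_analysis.

Set Implicit Arguments.
Unset Strict Implicit.
Unset Printing Implicit Defensive.

Import Order.TTheory GRing.Theory Num.Theory.
Import numFieldNormedType.Exports.

Local Open Scope classical_set_scope.
Local Open Scope ring_scope.

(** ** Smooth maps on open subsets of R^N *)

(* [Ck k U f] is only meant for [U] open and [V], [W] finite-dimensional, where
   it is the usual class C^k on [U]. *)
Fixpoint Ck (R : realType) (V W : normedModType R) (k : nat) (U : set V)
    (f : V -> W) {struct k} : Prop :=
  if k is k'.+1 then
    (forall x, U x -> differentiable f x) /\ (forall v, Ck k' U ('D_v f))
  else forall x, U x -> {for x, continuous f}.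

Definition smooth (R : realType) (V W : normedModType R) (U : set V)
    (f : V -> W) : Prop :=
  forall k, Ck k U f.

(** ** Calculus on embedded submanifolds M of R^N

    A function (or vector field) on M is represented by a total function on R^N
    of which only the values on M matter. *)

Definition embedded_submanifold (R : realType) (N d : nat)
    (M : set 'rV[R]_N) : Prop :=
  forall p, M p -> exists (c : nat) (U : set 'rV[R]_N)
      (F : 'rV[R]_N -> 'rV[R]_c),
    [/\ (d + c)%N = N, open U, U p, smooth U F &
        (forall x, U x -> (M x <-> F x = 0)) /\
        (forall x, U x -> M x -> forall w, exists v, 'D_v F x = w)].

Definition tangent (R : realType) (N : nat) (M : set 'rV[R]_N)
    (p : 'rV[R]_N) : set 'rV[R]_N :=
  [set v | exists (I : set R^o) (c : R^o -> 'rV[R]_N),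
     [/\ open I, I 0, smooth I c, forall t, I t -> M (c t) &
         c 0 = p /\ derive1 c 0 = v]].

Definition local_extension (R : realType) (N : nat) (W : normedModType R)
    (M : set 'rV[R]_N) (f : 'rV[R]_N -> W) (p : 'rV[R]_N)
    (F : 'rV[R]_N -> W) : Prop :=
  exists U : set 'rV[R]_N,
    [/\ open U, U p, smooth U F & forall x, U x -> M x -> F x = f x].

(* [A] is a subset of M, e.g. the domain of a partially defined map on M *)
Definition smooth_on (R : realType) (N : nat) (W : normedModType R)
    (M A : set 'rV[R]_N) (f : 'rV[R]_N -> W) : Prop :=
  forall p, M p -> A p -> exists F, local_extension M f p F.

(* The differential at p of f restricted to M. It is computed with some smooth
   local extension of f; for v tangent to M at p, the value does not depend on
   the extension. *)
Definition mdiff (R : realType) (N : nat) (W : normedModType R)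
    (M : set 'rV[R]_N) (f : 'rV[R]_N -> W) (p v : 'rV[R]_N) : W :=
  'D_v (xget f [set F | local_extension M f p F]) p.

Definition vector_field (R : realType) (N : nat) (M : set 'rV[R]_N)
    (Y : 'rV[R]_N -> 'rV[R]_N) : Prop :=
  smooth_on M setT Y /\ forall p, M p -> tangent M p (Y p).

(** ** Contact geometry

    A 1-form on M is given as the restriction of a 1-form [a] on R^N, where
    [a p v] is its value at the point p on the vector v. *)

Definition one_form (R : realType) (N : nat)
    (a : 'rV[R]_N -> 'rV[R]_N -> R) : Prop :=
  (forall p (s : R) u v, a p (s *: u + v) = s * a p u + a p v) /\
  (forall v, smooth setT (a ^~ v)).

(* Exterior derivative, d a (u, v) = u(a(v)) - v(a(u)) for constant fields;
   it commutes with the restriction to M. *)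
Definition dform (R : realType) (N : nat) (a : 'rV[R]_N -> 'rV[R]_N -> R)
    (p u v : 'rV[R]_N) : R :=
  'D_u (a ^~ v) p - 'D_v (a ^~ u) p.

(* ker a is a hyperplane field on M on which d a is nondegenerate. *)
Definition contact_form (R : realType) (N : nat) (M : set 'rV[R]_N)
    (a : 'rV[R]_N -> 'rV[R]_N -> R) : Prop :=
  [/\ one_form a,
      forall p, M p -> exists2 v, tangent M p v & a p v != 0 &
      forall p u, M p -> tangent M p u -> a p u = 0 ->
        (forall v, tangent M p v -> a p v = 0 -> dform a p u v = 0) -> u = 0].

Definition contact_manifold (R : realType) (N d : nat) (M : set 'rV[R]_N)
    (a : 'rV[R]_N -> 'rV[R]_N -> R) : Prop :=
  embedded_submanifold d M /\ contact_form M a.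

Definition is_reeb (R : realType) (N : nat) (M : set 'rV[R]_N)
    (a : 'rV[R]_N -> 'rV[R]_N -> R) (Z : 'rV[R]_N -> 'rV[R]_N) : Prop :=
  [/\ vector_field M Z, forall p, M p -> a p (Z p) = 1 &
      forall p v, M p -> tangent M p v -> dform a p (Z p) v = 0].

Definition lie_fun (R : realType) (N : nat) (M : set 'rV[R]_N)
    (Y : 'rV[R]_N -> 'rV[R]_N) (f : 'rV[R]_N -> R) (p : 'rV[R]_N) : R :=
  mdiff M f p (Y p).

(* Cartan's formula: L_Y a = i_Y d a + d (i_Y a) *)
Definition lie_form (R : realType) (N : nat) (M : set 'rV[R]_N)
    (Y : 'rV[R]_N -> 'rV[R]_N) (a : 'rV[R]_N -> 'rV[R]_N -> R)
    (p v : 'rV[R]_N) : R :=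
  dform a p (Y p) v + mdiff M (fun x => a x (Y x)) p v.

Definition contact_vector_field (R : realType) (N : nat) (M : set 'rV[R]_N)
    (a : 'rV[R]_N -> 'rV[R]_N -> R) (Y : 'rV[R]_N -> 'rV[R]_N) : Prop :=
  vector_field M Y /\
  exists2 rho : 'rV[R]_N -> R, smooth_on M setT rho &
    forall p v, M p -> tangent M p v -> lie_form M Y a p v = rho p * a p v.

(* Y is the contact vector field Y_f *)
Definition is_contact_field_of (R : realType) (N : nat) (M : set 'rV[R]_N)
    (a : 'rV[R]_N -> 'rV[R]_N -> R) (f : 'rV[R]_N -> R)
    (Y : 'rV[R]_N -> 'rV[R]_N) : Prop :=
  contact_vector_field M a Y /\ forall p, M p -> a p (Y p) = f p.

(* The Jacobi bracket [f, g], given Z and Yf = Y_f *)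
Definition jacobi_bracket (R : realType) (N : nat) (M : set 'rV[R]_N)
    (Z Yf : 'rV[R]_N -> 'rV[R]_N) (f g : 'rV[R]_N -> R) (p : 'rV[R]_N) : R :=
  lie_fun M Yf g p - g p * lie_fun M Z f p.

(* Phi is a map from M `&` D to M; [a p v] is preserved on that domain. *)
Definition contact_map (R : realType) (N : nat) (M D : set 'rV[R]_N)
    (a : 'rV[R]_N -> 'rV[R]_N -> R) (Phi : 'rV[R]_N -> 'rV[R]_N) : Prop :=
  [/\ forall p, M p -> D p -> M (Phi p),
      smooth_on M D Phi &
      forall p v, M p -> D p -> tangent M p v ->
        a (Phi p) (mdiff M Phi p v) = a p v].

(* Linear independence of the differentials on an open dense subset of M,
   i.e. on M `&` U with U open in R^N. *)
Definition functionally_independent (R : realType) (N m : nat)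
    (M : set 'rV[R]_N) (g : 'I_m -> 'rV[R]_N -> R) : Prop :=
  exists U : set 'rV[R]_N,
    [/\ open U, M `<=` closure (M `&` U) &
        forall p, M p -> U p -> forall c : 'I_m -> R,
          (forall v, tangent M p v -> \sum_i c i * mdiff M (g i) p v = 0) ->
          forall i, c i = 0].

(* The fields Z and Y_(g i) are unique on M since a is a contact form; they
   are quantified existentially. *)
Definition completely_integrable_contact (R : realType) (N d : nat)
    (M : set 'rV[R]_N) (a : 'rV[R]_N -> 'rV[R]_N -> R) (D : set 'rV[R]_N)
    (Phi : 'rV[R]_N -> 'rV[R]_N) : Prop :=
  [/\ contact_manifold d M a, contact_map M D a Phi &
   exists m : nat, d = (2 * m + 1)%N /\
   exists (g : 'I_m -> 'rV[R]_N -> R) (Z : 'rV[R]_N -> 'rV[R]_N)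
          (Y : 'I_m -> 'rV[R]_N -> 'rV[R]_N),
     [/\ (forall i, smooth_on M setT (g i)),
         is_reeb M a Z /\ (forall i, is_contact_field_of M a (g i) (Y i)),
         (forall i p, M p -> D p -> g i (Phi p) = g i p),
         (forall i p, M p -> lie_fun M Z (g i) p = 0) /\
         (forall i j p, M p -> jacobi_bracket M Z (Y i) (g i) (g j) p = 0) &
         functionally_independent M g]].

(** ** The Heisenberg model on the light-like cone of E^{k,l} *)

Definition tau (R : realType) (k l : nat) (i : 'I_(k + l)) : R :=
  if (i < k)%N then 1 else -1.

Definition pseudo_dot (R : realType) (k l : nat) (x y : 'rV[R]_(k + l)) : R :=
  \sum_i tau R i * x 0 i * y 0 i.

(* J^e x for J = diag(J_i) and e an integer *)
Definition Jpow (R : realType) (n : nat) (J : 'I_n -> R) (e : int)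
    (x : 'rV[R]_n) : 'rV[R]_n :=
  \row_i (J i ^ e * x 0 i).

(* Points (q, Q) are encoded as [row_mx q Q]. *)
Definition qpart (R : realType) (n : nat) (x : 'rV[R]_(n + n)) : 'rV[R]_n :=
  lsubmx x.
Definition Qpart (R : realType) (n : nat) (x : 'rV[R]_(n + n)) : 'rV[R]_n :=
  rsubmx x.

Definition light_cone (R : realType) (k l : nat) : set 'rV[R]_(k + l) :=
  [set q | pseudo_dot q q = 0].

Definition P0 (R : realType) (k l : nat) : set 'rV[R]_(k + l + (k + l)) :=
  [set x | light_cone (qpart x) /\ light_cone (Qpart x)].

Definition P0star (R : realType) (k l : nat) (J : 'I_(k + l) -> R) :
    set 'rV[R]_(k + l + (k + l)) :=
  [set x | P0 x /\ pseudo_dot (qpart x) (Jpow J (-1) (Qpart x)) != 0].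

Definition M_kappa (R : realType) (k l : nat) (J : 'I_(k + l) -> R)
    (kappa : R) : set 'rV[R]_(k + l + (k + l)) :=
  [set x | P0star J x /\
     (pseudo_dot (qpart x) (Jpow J 1 (Qpart x)) = kappa \/
      pseudo_dot (qpart x) (Jpow J 1 (Qpart x)) = - kappa)].

(* alpha = sum_i tau_i J_i Q_i dq_i *)
Definition alpha (R : realType) (k l : nat) (J : 'I_(k + l) -> R)
    (x v : 'rV[R]_(k + l + (k + l))) : R :=
  \sum_i tau R i * J i * Qpart x 0 i * qpart v 0 i.

Definition heis_dom (R : realType) (k l : nat) (J : 'I_(k + l) -> R) :
    set 'rV[R]_(k + l + (k + l)) :=
  [set x | pseudo_dot (Jpow J (-2) (Qpart x)) (Qpart x) != 0].

Definition heis_lambda (R : realType) (k l : nat) (J : 'I_(k + l) -> R)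
    (x : 'rV[R]_(k + l + (k + l))) : R :=
  2 * pseudo_dot (Jpow J (-1) (Qpart x)) (qpart x)
    / pseudo_dot (Jpow J (-2) (Qpart x)) (Qpart x).

(* meaningful on [heis_dom J] only *)
Definition heis_Phi (R : realType) (k l : nat) (J : 'I_(k + l) -> R)
    (x : 'rV[R]_(k + l + (k + l))) : 'rV[R]_(k + l + (k + l)) :=
  row_mx (Qpart x) (heis_lambda J x *: Jpow J (-1) (Qpart x) - qpart x).

(* Main.v *)
(** Write P = J Q, a_i = J_i^2 and m_ij = q_i P_j - q_j P_i. On the light-like
    cone the functions F_i = sum_j tau_j m_ij^2 / (a_i - a_j) are invariant under
    Phi, because m_ij^2 changes by (a_i - a_j) (q_i^2 Q_j^2 - q_j^2 Q_i^2).
    The Reeb field is (q, -Q) / <q, J Q>, and F_i generates an infinitesimal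
    rotation applied to q and P simultaneously, corrected by multiples of (0, q)
    and (q, -P), which do not move any m_ij; so the F_i commute as soon as they
    do in R^2n.

    There are n - 2 independent ones among them. Along the fibre over q the
    invariance under P -> P + s q reduces independence to the nonvanishing of a
    determinant det H(q, P). If no q_i vanishes, it is nonzero at
    P_i = g q_i / (a_i - z), where m_ij / (a_i - a_j) becomes a product of a
    function of i and a function of j. As det H is polynomial along the segment
    from a given P to this one, it is nonzero for P arbitrarily close to the
    given one; a shift along q then brings the point back to M_kappa. *)
From HB Require Import structures.
Require Import Defs.
From mathcomp Require Import all_boot all_order all_algebra.
From mathcomp Require Import all_classical all_reals all_analysis.
From mathcomp Require Import ring zify.

Set Implicit Arguments.
Unset Strict Implicit.
Unset Printing Implicit Defensive.

Import Order.TTheory GRing.Theory Num.Theory.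
Import numFieldNormedType.Exports.

Local Open Scope classical_set_scope.
Local Open Scope ring_scope.

(** * Smooth maps *)

(** Two of the n functions F_i must be dropped because of two relations: sum_i tau_i F_i = 0 by
    antisymmetry, and sum_i tau_i a_i F_i = <q,q><P,P> - <q,P>^2, which is the constant -kappa^2 on
    M_kappa. Any two distinct indices [o0], [o1] will do, since a_o0 and a_o1 differ. Tangent
    vectors are velocities of curves inside M_kappa, so solutions of the linearised equations have
    to be integrated to actual curves. The form being indefinite, a light-like q cannot be
    normalised; the direction transversal to its cone is [tauv q], which pairs positively with q and
    is itself light-like, so that the equation for returning to the cone is linear. In the momentum
    direction this part is played by <q, J^-1 Q> != 0: it makes alpha a contact form, it removes the
    J^-1 Q component in the independence argument, and it makes the quadratic equation for the shift
    along q solvable. All functions and fields on M_kappa are given by formulas that stay smooth on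
    an open neighbourhood, so their differentials are computed in R^2n. *)

Section SmoothCalculus.
Context {R : realType}.
Implicit Types (V W : normedModType R).

Lemma derive_lin V W (f : V -> W) (x v : V) :
  linear f -> continuous f -> 'D_v f x = f v.
Proof.
move=> flin fc.
pose fL : {linear V -> W} :=
  HB.pack f (GRing.isLinear.Build _ _ _ _ _ flin).
by rewrite (@deriveE _ _ _ fL) ?(@diff_lin _ _ _ fL) //; exact: linear_differentiable.
Qed.

Lemma lin_differentiable V W (f : V -> W) (x : V) :
  linear f -> continuous f -> differentiable f x.
Proof.
move=> flin fc.
pose fL : {linear V -> W} :=
  HB.pack f (GRing.isLinear.Build _ _ _ _ _ flin).
exact: (@linear_differentiable _ _ _ fL).
Qed.

Lemma derive_comp_lin V W W' (L : W -> W') (f : V -> W) (x v : V) :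
  linear L -> continuous L -> differentiable f x ->
  'D_v (fun y => L (f y)) x = L ('D_v f x).
Proof.
move=> Ll Lc df.
have dL := lin_differentiable (f x) Ll Lc.
rewrite deriveE; last exact: (differentiable_comp df dL).
have /(congr1 (fun h : V -> W' => h v)) /= -> := diff_comp df dL.
by rewrite -(deriveE _ df) -(deriveE _ dL) derive_lin.
Qed.

Lemma near_eq_differentiable V W (f g : V -> W) (x : V) :
  (\near x, f x = g x) -> differentiable f x -> differentiable g x.
Proof.
move=> fg df; have [dfc dfo] := (diff_locallyP _ _).1 df.
have fgx : f x = g x by exact: nbhs_singleton fg.
have dgo : g \o shift x = cst (g x) + 'd f x +o_ 0 id.
  move/eqaddoP: dfo => dfo; apply/eqaddoP => e e0.
  have := dfo e e0; apply: filter_app.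
  move: fg; rewrite (near_shift 0 x) /= => fg.
  near=> y.
  have -> : (g \o shift x - (cst (g x) + 'd f x)) y
      = (f \o shift x - (cst (f x) + 'd f x)) y; last by [].
  rewrite !fctE /= fgx; congr (_ - _).
  near: y; apply: filterS fg => y /=; by rewrite subr0.
have e : 'd g x = 'd f x :> (V -> W) by exact: diff_unique.
by apply/diff_locallyP; rewrite e.
Unshelve. all: by end_near. Qed.

(** The differentiation rules hold only at points of U, so ['D_v] of a product and its Leibniz
    formula may be different total functions; this lets the inductions below exchange them. *)
Lemma Ck_ext V W k (U : set V) (f g : V -> W) :
  open U -> (forall x, U x -> f x = g x) -> Ck k U f -> Ck k U g.
Proof.
move=> oU; elim: k f g => [|k IH] f g fg /=;
  have nfg x : U x -> \near x, f x = g x by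
    move=> Ux; near=> y; apply: fg; near: y; exact: open_nbhs_nbhs.
  move=> fc x Ux.
  rewrite /prop_for /continuous_at -(fg x Ux).
  by apply: cvg_trans (fc x Ux); apply: near_eq_cvg; exact: nfg.
case=> df Df; split=> [x Ux|v].
  exact: near_eq_differentiable (nfg x Ux) (df x Ux).
apply: (IH ('D_v f)) (Df v) => x Ux.
exact: near_eq_derive (nfg x Ux).
Unshelve. all: by end_near. Qed.

(** Leibniz multiplies a C^k derivative by a C^(k+1) factor, so the inductions for products and
    inverses must forget one order. *)
Lemma CkW V W k (U : set V) (f : V -> W) : Ck k.+1 U f -> Ck k U f.
Proof.
elim: k f => [|k IH] f [df Df].
  by move=> x Ux; exact/differentiable_continuous/df.
by split=> // v; apply: IH.
Qed.

Lemma Ck_cst V W k (U : set V) (w : W) : Ck k U (fun=> w).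
Proof.
elim: k w => [|k IH] w /=; first by move=> x _; exact: cvg_cst.
split=> [x _|v]; first exact: differentiable_cst.
rewrite (_ : 'D_v _ = fun=> 0) //.
by apply/funext => x; rewrite derive_cst.
Qed.

Lemma Ck_lin V W k (U : set V) (f : V -> W) :
  linear f -> continuous f -> Ck k U f.
Proof.
move=> fl fc; case: k => [|k] /=; first by move=> x _; exact: fc.
split=> [x _|v]; first exact: lin_differentiable.
rewrite (_ : 'D_v _ = fun=> f v); first exact: Ck_cst.
by apply/funext => x; rewrite derive_lin.
Qed.

Lemma CkD V W k (U : set V) (f g : V -> W) : open U ->
  Ck k U f -> Ck k U g -> Ck k U (fun x => f x + g x).
Proof.
move=> oU; elim: k f g => [|k IH] f g /=.
  by move=> fc gc x Ux; apply: cvgD; [exact: fc|exact: gc].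
move=> [df Df] [dg Dg]; split=> [x Ux|v].
  exact: differentiableD (df x Ux) (dg x Ux).
apply: (Ck_ext oU _ (IH _ _ (Df v) (Dg v))) => x Ux.
by rewrite (deriveD (diff_derivable (df x Ux)) (diff_derivable (dg x Ux))).
Qed.

Lemma Ck_comp_lin V W W' k (U : set V) (L : W -> W') (f : V -> W) : open U ->
  linear L -> continuous L -> Ck k U f -> Ck k U (fun x => L (f x)).
Proof.
move=> oU Ll Lc; elim: k f => [|k IH] f /=.
  by move=> fc x Ux; apply: continuous_comp; [exact: fc|exact: Lc].
move=> [df Df]; split=> [x Ux|v].
  apply: (@differentiable_comp _ _ _ _ f L); first exact: df.
  exact: lin_differentiable.
apply: (Ck_ext oU _ (IH _ (Df v))) => x Ux.
by rewrite (derive_comp_lin v Ll Lc (df x Ux)).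
Qed.

Lemma CkM V k (U : set V) (f g : V -> R) : open U ->
  Ck k U f -> Ck k U g -> Ck k U (fun x => f x * g x).
Proof.
move=> oU; elim: k f g => [|k IH] f g.
  by move=> fc gc x Ux; apply: cvgM; [exact: fc|exact: gc].
move=> fk gk; have [df Df] := fk; have [dg Dg] := gk; split=> [x Ux|v].
  exact: differentiableM (df x Ux) (dg x Ux).
have := CkD oU (IH _ _ (CkW fk) (Dg v)) (IH _ _ (CkW gk) (Df v)).
apply: Ck_ext => // x Ux.
by rewrite (deriveM (diff_derivable (df x Ux)) (diff_derivable (dg x Ux))).
Qed.

Lemma CkV V k (U : set V) (f : V -> R) : open U -> (forall x, U x -> f x != 0) ->
  Ck k U f -> Ck k U (fun x => (f x)^-1).
Proof.
move=> oU f0; elim: k => [|k IH] fk.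
  by move=> x Ux; apply: cvgV; [exact: f0|exact: fk].
have [df Df] := fk; split=> [x Ux|v].
  exact: differentiableV (df x Ux) (f0 x Ux).
have ik := IH (CkW fk).
have := CkM oU (Ck_cst k U (-1 : R)) (CkM oU (CkM oU ik ik) (Df v)).
apply: Ck_ext => // x Ux.
rewrite deriveV ?f0//; last by apply: diff_derivable; exact: df.
by rewrite mulN1r expr2 invfM scaleNr.
Qed.

Lemma Ck_sub V W k (U U' : set V) (f : V -> W) : U' `<=` U ->
  Ck k U f -> Ck k U' f.
Proof.
move=> sU; elim: k f => [|k IH] f /=; first by move=> fc x /sU; exact: fc.
by move=> [df Df]; split=> [x /sU|v]; [exact: df|exact/IH/Df].
Qed.

Lemma smooth_differentiable V W (U : set V) (f : V -> W) x :
  smooth U f -> U x -> differentiable f x.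
Proof. by move=> /(_ 1%N)[df _]; exact: df. Qed.

Lemma smooth_continuous V W (U : set V) (f : V -> W) x :
  smooth U f -> U x -> {for x, continuous f}.
Proof. by move=> /(_ 0%N) /[apply]. Qed.

Lemma smooth_ext V W (U : set V) (f g : V -> W) : open U ->
  (forall x, U x -> f x = g x) -> smooth U f -> smooth U g.
Proof. by move=> oU fg fs k; exact: Ck_ext (fs k). Qed.

Lemma smooth_sub V W (U U' : set V) (f : V -> W) : U' `<=` U ->
  smooth U f -> smooth U' f.
Proof. by move=> sU fs k; exact: Ck_sub (fs k). Qed.

Lemma smooth_cst V W (U : set V) (w : W) : smooth U (fun=> w).
Proof. by move=> k; exact: Ck_cst. Qed.

Lemma smooth_lin V W (U : set V) (f : V -> W) :
  linear f -> continuous f -> smooth U f.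
Proof. by move=> *; move=> k; exact: Ck_lin. Qed.

Lemma smoothD V W (U : set V) (f g : V -> W) : open U ->
  smooth U f -> smooth U g -> smooth U (fun x => f x + g x).
Proof. by move=> oU fs gs k; exact: CkD. Qed.

Lemma smooth_comp_lin V W W' (U : set V) (L : W -> W') (f : V -> W) : open U ->
  linear L -> continuous L -> smooth U f -> smooth U (fun x => L (f x)).
Proof. by move=> oU Ll Lc fs k; exact: Ck_comp_lin. Qed.

Lemma smoothM V (U : set V) (f g : V -> R) : open U ->
  smooth U f -> smooth U g -> smooth U (fun x => f x * g x).
Proof. by move=> oU fs gs k; exact: CkM. Qed.

Lemma smoothV V (U : set V) (f : V -> R) : open U ->
  (forall x, U x -> f x != 0) -> smooth U f -> smooth U (fun x => (f x)^-1).
Proof. by move=> oU f0 fs k; exact: CkV. Qed.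

Lemma smoothN V (U : set V) (f : V -> R) : open U ->
  smooth U f -> smooth U (fun x => - f x).
Proof.
move=> oU fs; apply: (smooth_ext oU _ (smoothM oU (smooth_cst U (-1 : R)) fs)).
by move=> x _; rewrite mulN1r.
Qed.

Lemma smoothB V (U : set V) (f g : V -> R) : open U ->
  smooth U f -> smooth U g -> smooth U (fun x => f x - g x).
Proof. by move=> oU fs gs; apply: smoothD => //; exact: smoothN. Qed.

Lemma smooth_sum V W (I : Type) (r : seq I) (U : set V) (f : I -> V -> W) :
  open U -> (forall i, smooth U (f i)) -> smooth U (fun x => \sum_(i <- r) f i x).
Proof.
move=> oU fs; elim: r => [|i r IH].
  by apply: (smooth_ext oU _ (smooth_cst U 0)) => x _; rewrite big_nil.
apply: (smooth_ext oU _ (smoothD oU (fs i) IH)) => x _.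
by rewrite big_cons.
Qed.

Lemma smooth_coord n (U : set 'rV[R]_n) i : smooth U (fun x => x 0 i : R).
Proof.
apply: smooth_lin; last exact: coord_continuous.
by move=> a u v; rewrite !mxE.
Qed.

Lemma smoothZl V W (U : set V) (f : V -> R) (w : W) : open U ->
  smooth U f -> smooth U (fun x => f x *: w).
Proof.
move=> oU; apply: (smooth_comp_lin (L := fun a : R => a *: w)) => //.
  by move=> a u v; rewrite scalerDl scalerA.
exact: scalel_continuous.
Qed.

Lemma smooth_row V n (U : set V) (f : V -> 'rV[R]_n) : open U ->
  (forall i, smooth U (fun x => f x 0 i)) -> smooth U f.
Proof.
move=> oU fs.
apply: (smooth_ext oU _ (smooth_sum (index_enum 'I_n) oU
   (fun i => smoothZl (delta_mx 0 i : 'rV[R]_n) oU (fs i)))) => x _.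
by rewrite [RHS]row_sum_delta.
Qed.

Lemma smooth_row_coord V n (U : set V) (f : V -> 'rV[R]_n) i : open U ->
  smooth U f -> smooth U (fun x => f x 0 i).
Proof.
move=> oU; apply: (smooth_comp_lin (L := fun x : 'rV[R]_n => x 0 i)) => //.
  by move=> a u v; rewrite !mxE.
exact: coord_continuous.
Qed.

End SmoothCalculus.

(** * Differentials and tangent vectors on submanifolds *)

Section Submanifolds.
Context {R : realType} {N : nat}.
Implicit Types (W : normedModType R) (M : set 'rV[R]_N).

Lemma derive_along_curve W (F : 'rV[R]_N -> W) (c : R^o -> 'rV[R]_N) :
  differentiable c 0 -> differentiable F (c 0) ->
  'D_(derive1 c 0) F (c 0) = derive1 (F \o c) 0.
Proof.
move=> dc dF; rewrite derive1E' // derive1E'; last exact: differentiable_comp.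
have /(congr1 (fun h : R^o -> W => h 1)) /= -> := diff_comp dc dF.
by rewrite deriveE.
Qed.

(** A curve in M with velocity v stays where both extensions equal f, so their compositions with it
    agree near 0, and the chain rule reads off the derivatives. *)
Lemma local_extension_derive W M (f F G : 'rV[R]_N -> W) p v :
  local_extension M f p F -> local_extension M f p G -> tangent M p v ->
  'D_v F p = 'D_v G p.
Proof.
move=> [U [oU Up sF Ff]] [U' [oU' U'p sG Gf]] [I [c [oI I0 sc Mc [c0 cv]]]].
have dc := smooth_differentiable sc I0.
have dF : differentiable F (c 0) by rewrite c0; exact: smooth_differentiable sF Up.
have dG : differentiable G (c 0) by rewrite c0; exact: smooth_differentiable sG U'p.
rewrite -cv -c0 !derive_along_curve // !derive1E.
apply: near_eq_derive.
have cc := smooth_continuous sc I0.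
have cU : \forall t \near (0 : R^o), U (c t).
  by apply: cc; rewrite c0; exact: open_nbhs_nbhs.
have cU' : \forall t \near (0 : R^o), U' (c t).
  by apply: cc; rewrite c0; exact: open_nbhs_nbhs.
have nI : \forall t \near (0 : R^o), I t by exact: open_nbhs_nbhs.
near=> t => /=.
have It : I t by near: t.
have Ut : U (c t) by near: t.
have U't : U' (c t) by near: t.
by rewrite Ff ?Gf //; exact: Mc.
Unshelve. all: by end_near. Qed.

Lemma mdiffE W M (f F : 'rV[R]_N -> W) p v :
  local_extension M f p F -> tangent M p v -> mdiff M f p v = 'D_v F p.
Proof.
move=> Fe tv; rewrite /mdiff.
set X := [set _ | _]; have XF : X F by [].
exact: local_extension_derive (xgetPex f (ex_intro X F XF)) Fe tv.
Qed.

Lemma smooth_local_extension W M (U : set 'rV[R]_N) (f : 'rV[R]_N -> W) p :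
  open U -> smooth U f -> U p -> local_extension M f p f.
Proof. by move=> oU sf Up; exists U. Qed.

(** Both F and the constant 0 extend the zero function on M. *)
Lemma tangent_derive0 W M (F : 'rV[R]_N -> W) p v :
  smooth setT F -> (forall x, M x -> F x = 0) -> tangent M p v -> 'D_v F p = 0.
Proof.
move=> sF F0 tv.
have e0 : local_extension M (fun=> 0) p F.
  by exists setT; split => //; [exact: openT|move=> x _; exact: F0].
have e1 : local_extension M (fun=> 0 : W) p (fun=> 0).
  by exists setT; split => //; [exact: openT|exact: smooth_cst].
by rewrite (local_extension_derive e0 e1 tv) derive_cst.
Qed.

End Submanifolds.

(** * Pseudo-Euclidean algebra and the integrals *)

Section PseudoEuclidean.
Context {R : realType} {k l : nat}.
Local Notation vec := 'rV[R]_(k + l).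
Implicit Types (x y z : vec).

Lemma tau_sq (i : 'I_(k + l)) : tau R i * tau R i = 1.
Proof. by rewrite /tau; case: ifP => _; rewrite ?mulr1 ?mulrNN ?mulr1. Qed.

Lemma dotC x y : pseudo_dot x y = pseudo_dot y x.
Proof. by apply: eq_bigr => i _; rewrite mulrAC. Qed.

Lemma dotP (a : R) x y z :
  pseudo_dot (a *: x + y) z = a * pseudo_dot x z + pseudo_dot y z.
Proof.
rewrite /pseudo_dot mulr_sumr -big_split; apply: eq_bigr => i _ /=.
by rewrite !mxE; ring.
Qed.

Lemma dot0l x : pseudo_dot 0 x = 0.
Proof. by rewrite /pseudo_dot big1 // => i _; rewrite mxE mulr0 mul0r. Qed.

Lemma dotZl (a : R) x y : pseudo_dot (a *: x) y = a * pseudo_dot x y.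
Proof. by rewrite -[a *: x]addr0 dotP dot0l addr0. Qed.

Lemma dotDl x y z : pseudo_dot (x + y) z = pseudo_dot x z + pseudo_dot y z.
Proof. by rewrite -{1}[x]scale1r dotP mul1r. Qed.

Lemma dotNl x y : pseudo_dot (- x) y = - pseudo_dot x y.
Proof. by rewrite -scaleN1r dotZl mulN1r. Qed.

Lemma dotBl x y z : pseudo_dot (x - y) z = pseudo_dot x z - pseudo_dot y z.
Proof. by rewrite dotDl dotNl. Qed.

Lemma dot0r x : pseudo_dot x 0 = 0.
Proof. by rewrite dotC dot0l. Qed.

Lemma dotZr (a : R) x y : pseudo_dot x (a *: y) = a * pseudo_dot x y.
Proof. by rewrite dotC dotZl dotC. Qed.

Lemma dotDr x y z : pseudo_dot x (y + z) = pseudo_dot x y + pseudo_dot x z.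
Proof. by rewrite dotC dotDl !(dotC x). Qed.

Lemma dotNr x y : pseudo_dot x (- y) = - pseudo_dot x y.
Proof. by rewrite dotC dotNl dotC. Qed.

Lemma dotBr x y z : pseudo_dot x (y - z) = pseudo_dot x y - pseudo_dot x z.
Proof. by rewrite dotDr dotNr. Qed.

Definition dotE := (dotDl, dotDr, dotNl, dotNr, dotZl, dotZr).

Lemma dot_delta (i : 'I_(k + l)) x :
  pseudo_dot (delta_mx 0 i) x = tau R i * x 0 i.
Proof.
rewrite /pseudo_dot (bigD1 i) //= big1 ?addr0 => [|j ji]; rewrite mxE eqxx /=.
  by rewrite eqxx mulr1.
by rewrite (negbTE ji) mulr0 mul0r.
Qed.

Lemma dot_inj x y : (forall z, pseudo_dot x z = pseudo_dot y z) -> x = y.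
Proof.
move=> xy; apply/rowP => i; have := xy (delta_mx 0 i).
rewrite ![pseudo_dot _ (delta_mx _ _)]dotC !dot_delta.
by move=> /(congr1 ( *%R (tau R i))); rewrite !mulrA tau_sq !mul1r.
Qed.

(** Pairing x with [tauv y] gives the Euclidean product of x and y. For light-like x != 0 this
    yields a vector transversal to the cone that is again light-like. *)
Definition tauv (x : vec) : vec := \row_i (tau R i * x 0 i).

Lemma dot_tauv x y : pseudo_dot (tauv x) (tauv y) = pseudo_dot x y.
Proof.
apply: eq_bigr => i _; rewrite !mxE.
by rewrite -[RHS]mul1r -(tau_sq i); ring.
Qed.

Lemma dot_tauv_gt0 x : x != 0 -> 0 < pseudo_dot x (tauv x).
Proof.
move=> x0; have -> : pseudo_dot x (tauv x) = \sum_i (x 0 i) ^+ 2.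
  apply: eq_bigr => i _; rewrite !mxE.
  by rewrite -[RHS]mul1r -(tau_sq i); ring.
rewrite lt0r sumr_ge0 ?andbT => [|i _]; last exact: sqr_ge0.
apply: contra x0 => /eqP s0; apply/eqP/rowP => i; rewrite mxE.
apply/eqP; rewrite -sqrf_eq0; apply/eqP.
by apply: (psumr_eq0P _ s0) => // j _; exact: sqr_ge0.
Qed.

(** The plane of x and y has Gram determinant -<x,y>^2, so it is nondegenerate and every w splits
    into a part in the plane and a part orthogonal to it. The coefficients a, b are those of the
    projection of z. *)
Lemma dot_span x y z : pseudo_dot x x = 0 -> pseudo_dot x y != 0 ->
  (forall v, pseudo_dot x v = 0 -> pseudo_dot y v = 0 -> pseudo_dot z v = 0) ->
  exists a b, z = a *: x + b *: y.
Proof.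
move=> xx xy zv; set s := pseudo_dot x y in xy *.
pose b := pseudo_dot z x / s.
pose a := (pseudo_dot z y - b * pseudo_dot y y) / s.
exists a, b; apply: dot_inj => w.
pose d := pseudo_dot w x / s.
pose c := (pseudo_dot w y - d * pseudo_dot y y) / s.
have wv : pseudo_dot z (w - c *: x - d *: y) = 0.
  apply: zv; rewrite !dotE ?xx.
    by rewrite (dotC x w) -/s /d; field.
  by rewrite (dotC y w) (dotC y x) -/s /c; field.
move: wv; rewrite !dotE => /eqP; rewrite -addrA -opprD subr_eq0 => /eqP ->.
by rewrite /a /b /c /d (dotC x w) (dotC y w); field.
Qed.

End PseudoEuclidean.

(** * Angular momenta and infinitesimal rotations *)

Section AngularMomentum.
Context {R : realType} {k l : nat} (J : 'I_(k + l) -> R).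
Local Notation vec := 'rV[R]_(k + l).
Implicit Types (q P x y : vec) (i j h : 'I_(k + l)).

Lemma JpowD (e : int) x y : Jpow J e (x + y) = Jpow J e x + Jpow J e y.
Proof. by apply/rowP => i; rewrite !mxE mulrDr. Qed.

Lemma JpowZ (e : int) (a : R) x : Jpow J e (a *: x) = a *: Jpow J e x.
Proof. by apply/rowP => i; rewrite !mxE mulrCA. Qed.

Lemma JpowN (e : int) x : Jpow J e (- x) = - Jpow J e x.
Proof. by apply/rowP => i; rewrite !mxE mulrN. Qed.

Lemma Jpow0r (e : int) : Jpow J e 0 = 0.
Proof. by apply/rowP => i; rewrite !mxE mulr0. Qed.

Lemma Jpow_dot (e : int) x y : pseudo_dot (Jpow J e x) y = pseudo_dot x (Jpow J e y).
Proof. by apply: eq_bigr => i _; rewrite !mxE; ring. Qed.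

Definition JpowE := (JpowD, JpowN, JpowZ, Jpow0r).

Definition moment q P i j : R := q 0 i * P 0 j - q 0 j * P 0 i.

(* The entry [j = i] is 0 / 0 = 0, here and in [integral_form]. *)
Definition moment_row q P i : vec :=
  \row_j (moment q P i j / (J i ^+ 2 - J j ^+ 2)).

Definition integral_form q P i : R :=
  \sum_j tau R j * moment q P i j ^+ 2 / (J i ^+ 2 - J j ^+ 2).

(* The infinitesimal rotation generated by half of [integral_form] *)
Definition rotation q P i x : vec :=
  x 0 i *: moment_row q P i
  - (tau R i * pseudo_dot (moment_row q P i) x) *: delta_mx 0 i.

(** The sign in [rotation] cancels the one in <e_i, y>; what remains is the wedge of the i-th
    coordinate with [moment_row], visibly skew in x and y. *)
Lemma rotation_dot q P i x y : pseudo_dot (rotation q P i x) y =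
  x 0 i * pseudo_dot (moment_row q P i) y
  - pseudo_dot (moment_row q P i) x * y 0 i.
Proof.
by rewrite !dotE dot_delta mulrACA tau_sq mul1r.
Qed.

Lemma rotation_coord q P i h x : h != i ->
  rotation q P i x 0 h = x 0 i * moment_row q P i 0 h.
Proof.
by move=> hi; rewrite ![in LHS]mxE (negbTE hi) andbF mulr0 subr0 [in RHS]mxE.
Qed.

Lemma rotation_antisym q P i x y :
  pseudo_dot (rotation q P i x) y = - pseudo_dot (rotation q P i y) x.
Proof. by rewrite !rotation_dot; ring. Qed.

Lemma rotation_dotxx q P i x : pseudo_dot (rotation q P i x) x = 0.
Proof. by rewrite rotation_dot; ring. Qed.

(** Euler's identity: F_i is homogeneous quadratic in P, with gradient 2 [rotation q P i q] in P. *)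
Lemma rotation_momentum q P i : pseudo_dot (rotation q P i q) P = integral_form q P i.
Proof.
rewrite rotation_dot [X in _ - X]mulrC /pseudo_dot !mulr_sumr -sumrB.
apply: eq_bigr => j _; rewrite !mxE.
rewrite /moment; set d := (_ - _)^-1.
rewrite -/(moment q P i j) /moment. ring.
Qed.

Hypothesis J_sqr : forall i j, i != j -> J i ^+ 2 != J j ^+ 2.

Lemma moment_row_sym q P i j : moment_row q P i 0 j = moment_row q P j 0 i.
Proof.
by rewrite !mxE -[in RHS]opprB invrN mulrN -mulNr; congr (_ / _); rewrite /moment; ring.
Qed.

Lemma momentE q P i j :
  moment q P i j = moment_row q P i 0 j * (J i ^+ 2 - J j ^+ 2).
Proof.
rewrite mxE; have [->|ij] := eqVneq i j; first by rewrite /moment !subrr !mul0r.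
by rewrite divfK // subr_eq0; exact: J_sqr.
Qed.

(** This is the vanishing of the Poisson bracket of F_h and F_i in R^2n. With r the symmetric array
    of the [moment_row] entries, each summand is r_hi r_hj r_ij times (a_h - a_i) - (a_h - a_j) -
    (a_j - a_i) = 0. *)
Lemma rotation_commute q P i h : pseudo_dot (rotation q P h q) (rotation q P i P) =
  pseudo_dot (rotation q P h P) (rotation q P i q).
Proof.
have [->|hi] := eqVneq h i; first exact: dotC.
have key : moment q P h i * pseudo_dot (moment_row q P h) (moment_row q P i)
  - moment_row q P h 0 i * (q 0 h * pseudo_dot (moment_row q P i) P
                             - P 0 h * pseudo_dot (moment_row q P i) q)
  - moment_row q P h 0 i * (P 0 i * pseudo_dot (moment_row q P h) q
                             - q 0 i * pseudo_dot (moment_row q P h) P) = 0.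
  rewrite /pseudo_dot !mulr_sumr -!sumrB !mulr_sumr -!sumrB.
  apply: big1 => j _.
  rewrite [LHS](_ : _ = tau R j * (
    moment q P h i * moment_row q P h 0 j * moment_row q P i 0 j
    - moment_row q P h 0 i * moment_row q P i 0 j * moment q P h j
    - moment_row q P h 0 i * moment_row q P h 0 j * moment q P j i)).
    rewrite !momentE (moment_row_sym q P j i); ring.
  by rewrite /moment; ring.
have e x y : pseudo_dot (rotation q P h x) (rotation q P i y) =
   x 0 h * (y 0 i * pseudo_dot (moment_row q P h) (moment_row q P i)
     - pseudo_dot (moment_row q P i) y * moment_row q P h 0 i)
   - pseudo_dot (moment_row q P h) x * (y 0 i * moment_row q P h 0 i).
  rewrite rotation_dot dotC rotation_dot (dotC (moment_row q P i) (moment_row q P h)).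
  rewrite (rotation_coord q P y hi) (moment_row_sym q P i h); ring.
apply/eqP; rewrite -subr_eq0 !e; apply/eqP; rewrite -[RHS]key /moment; ring.
Qed.

End AngularMomentum.

(** * Smooth vector-valued maps and the differentials of the integrals *)

Section SmoothVectors.
Context {R : realType}.
Implicit Types (V : normedModType R).

Lemma smooth_rowZ V n (U : set V) (f : V -> R) (g : V -> 'rV[R]_n) : open U ->
  smooth U f -> smooth U g -> smooth U (fun x => f x *: g x).
Proof.
move=> oU fs gs; apply: smooth_row => // i.
apply: (smooth_ext oU _ (smoothM oU fs (smooth_row_coord i oU gs))) => x _.
by rewrite mxE.
Qed.

Lemma smooth_rowN V n (U : set V) (g : V -> 'rV[R]_n) : open U ->
  smooth U g -> smooth U (fun x => - g x).
Proof.
move=> oU gs; apply: smooth_row => // i.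
apply: (smooth_ext oU _ (smoothN oU (smooth_row_coord i oU gs))) => x _.
by rewrite mxE.
Qed.

Lemma smooth_row_mx V m n (U : set V) (f : V -> 'rV[R]_m) (g : V -> 'rV[R]_n) :
  open U -> smooth U f -> smooth U g -> smooth U (fun x => row_mx (f x) (g x)).
Proof.
move=> oU fs gs; apply: smooth_row => // i; case: (splitP i) => j ij.
  apply: (smooth_ext oU _ (smooth_row_coord j oU fs)) => x _.
  by rewrite (_ : i = lshift n j) ?row_mxEl //; exact: val_inj.
apply: (smooth_ext oU _ (smooth_row_coord j oU gs)) => x _.
by rewrite (_ : i = rshift m j) ?row_mxEr //; exact: val_inj.
Qed.

Lemma smooth_dot V k l (U : set V) (f g : V -> 'rV[R]_(k + l)) : open U ->
  smooth U f -> smooth U g -> smooth U (fun x => pseudo_dot (f x) (g x)).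
Proof.
move=> oU fs gs; apply: smooth_sum => // i.
apply: smoothM => //; last exact: smooth_row_coord.
apply: smoothM => //; [exact: smooth_cst|exact: smooth_row_coord].
Qed.

Lemma smooth_Jpow V n (J : 'I_n -> R) (e : int) (U : set V) (f : V -> 'rV[R]_n) :
  open U -> smooth U f -> smooth U (fun x => Jpow J e (f x)).
Proof.
move=> oU fs; apply: smooth_row => // i.
apply: (smooth_ext oU _ (smoothM oU (smooth_cst U (J i ^ e)) (smooth_row_coord i oU fs))).
by move=> x _; rewrite mxE.
Qed.

Lemma smooth_qpart n (U : set 'rV[R]_(n + n)) : open U -> smooth U (@qpart R n).
Proof.
move=> oU; apply: smooth_row => // i.
apply: (smooth_ext oU _ (smooth_coord U (lshift n i))) => x _.
by rewrite mxE.
Qed.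

Lemma smooth_Qpart n (U : set 'rV[R]_(n + n)) : open U -> smooth U (@Qpart R n).
Proof.
move=> oU; apply: smooth_row => // i.
apply: (smooth_ext oU _ (smooth_coord U (rshift n i))) => x _.
by rewrite mxE.
Qed.

Lemma is_derive_qpart n (x v : 'rV[R]_(n + n)) i :
  is_derive x v (fun y => qpart y 0 i) (qpart v 0 i).
Proof.
have fl : linear (fun y : 'rV[R]_(n + n) => qpart y 0 i) by move=> a u w; rewrite !mxE.
have fc : continuous (fun y : 'rV[R]_(n + n) => qpart y 0 i).
  by move=> y; apply: (smooth_continuous (smooth_row_coord i openT (smooth_qpart openT))).
apply: DeriveDef; last exact: derive_lin.
exact/diff_derivable/lin_differentiable.
Qed.

Lemma is_derive_Qpart n (x v : 'rV[R]_(n + n)) i :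
  is_derive x v (fun y => Qpart y 0 i) (Qpart v 0 i).
Proof.
have fl : linear (fun y : 'rV[R]_(n + n) => Qpart y 0 i) by move=> a u w; rewrite !mxE.
have fc : continuous (fun y : 'rV[R]_(n + n) => Qpart y 0 i).
  by move=> y; apply: (smooth_continuous (smooth_row_coord i openT (smooth_Qpart openT))).
apply: DeriveDef; last exact: derive_lin.
exact/diff_derivable/lin_differentiable.
Qed.

Lemma is_derive_fsum V n (f : 'I_n -> V -> R) (df : 'I_n -> R) (x v : V) :
  (forall i, is_derive x v (f i) (df i)) ->
  is_derive x v (fun y => \sum_i f i y) (\sum_i df i).
Proof.
by move=> /is_derive_sum; rewrite (_ : \sum_i f i = fun y => \sum_i f i y) // fct_sumE.
Qed.

Lemma is_derive_dot V k l (f g : V -> 'rV[R]_(k + l)) (df dg : 'rV[R]_(k + l)) x v :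
  (forall i, is_derive x v (fun y => f y 0 i) (df 0 i)) ->
  (forall i, is_derive x v (fun y => g y 0 i) (dg 0 i)) ->
  is_derive x v (fun y => pseudo_dot (f y) (g y))
    (pseudo_dot df (g x) + pseudo_dot (f x) dg).
Proof.
move=> fd gd; rewrite /pseudo_dot -big_split /=; apply: is_derive_fsum => i.
have h := is_deriveM (is_deriveM (is_derive_cst (tau R i) x v) (fd i)) (gd i).
apply: is_derive_eq h _.
by rewrite /cst /= !scaler0 addr0 /GRing.scale !fctE /=; ring.
Qed.

Section Integrals.
Variables (k l : nat) (J : 'I_(k + l) -> R).
Local Notation pt := 'rV[R]_(k + l + (k + l)).
Implicit Types (x v : pt).

Definition mom x := Jpow J 1 (Qpart x).

Definition heis_integral (i : 'I_(k + l)) x := integral_form J (qpart x) (mom x) i.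

(* [locked]: otherwise the bilinearity rules would rewrite inside its body *)
Definition xrot i x := locked (rotation J (qpart x) (mom x) i).

Lemma xrotE i x : xrot i x = rotation J (qpart x) (mom x) i.
Proof. by rewrite /xrot -lock. Qed.

Lemma smooth_integral i (U : set pt) : open U -> smooth U (heis_integral i).
Proof.
move=> oU.
have sq j := smooth_row_coord j oU (smooth_qpart oU).
have sP j := smooth_row_coord j oU (smooth_Jpow J 1 oU (smooth_Qpart oU)).
have sm j : smooth U (fun x => moment (qpart x) (mom x) i j).
  by apply: smoothB => //; apply: smoothM.
apply: smooth_sum => // j; apply: smoothM => //; last exact: smooth_cst.
apply: smoothM => //; first exact: smooth_cst.
by apply: smoothM.
Qed.

Lemma is_derive_mom x v i :
  is_derive x v (fun y => mom y 0 i) (mom v 0 i).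
Proof.
have h := is_deriveM (is_derive_cst (J i ^ 1) x v) (is_derive_Qpart x v i).
apply: (near_eq_is_derive _ (is_derive_eq h _)); last first.
  by rewrite scaler0 addr0 [RHS]mxE.
by near=> y; rewrite [RHS]mxE.
Unshelve. all: by end_near. Qed.

(** By Hamilton's equations the field of F_i in the variables (q, P) is therefore 2 [xrot] applied
    to q and to P. *)
Lemma derive_integral i x v : 'D_v (heis_integral i) x =
  2 * (pseudo_dot (xrot i x (qpart x)) (mom v) - pseudo_dot (xrot i x (mom x)) (qpart v)).
Proof.
have dq j := is_derive_qpart x v j.
have dP j := is_derive_mom x v j.
pose dm j := qpart x 0 i * mom v 0 j + mom x 0 j * qpart v 0 i
   - (qpart x 0 j * mom v 0 i + mom x 0 i * qpart v 0 j).
pose m j := moment (qpart x) (mom x) i j.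
have mD j : is_derive x v (fun y => moment (qpart y) (mom y) i j) (dm j).
  exact: is_deriveB (is_deriveM (dq i) (dP j)) (is_deriveM (dq j) (dP i)).
have D : is_derive x v (heis_integral i)
    (\sum_j tau R j * (m j * dm j + m j * dm j) / (J i ^+ 2 - J j ^+ 2)).
  apply: is_derive_fsum => j.
  have h := is_deriveM (is_deriveM (is_derive_cst (tau R j) x v)
     (is_deriveM (mD j) (mD j))) (is_derive_cst (J i ^+ 2 - J j ^+ 2)^-1 x v).
  apply: is_derive_eq h _.
  by rewrite /cst /GRing.scale !fctE /= /m; ring.
rewrite derive_val !xrotE !rotation_dot /pseudo_dot !mulr_sumr !mulr_suml -!sumrB mulr_sumr.
apply: eq_bigr => j _; rewrite [moment_row _ _ _ _ _ _]mxE /dm /m; ring.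
Qed.

End Integrals.
End SmoothVectors.

Lemma smooth_open_neq0 (R : realType) (V : normedModType R) (U : set V) (f : V -> R) :
  open U -> smooth U f -> open [set x | U x /\ f x != 0].
Proof.
move=> oU sf; rewrite openE => x [Ux fx0].
have fc := smooth_continuous sf Ux.
have nU : \forall y \near x, U y by exact: open_nbhs_nbhs.
have nf : \forall y \near x, f y != 0 by exact: (cvgr_neq0 _ fc fx0).
by rewrite /interior /=; apply: filterS2 nU nf => y; split.
Qed.

(** The difference quotient is v + h r(h), so a second-order correction of a straight line leaves
    its velocity unchanged. *)
Lemma derive1_second_order (R : realType) (V : normedModType R) (p v : V)
    (r : R^o -> V) : {for 0, continuous r} ->
  derive1 (fun t : R^o => p + t *: v + t ^+ 2 *: r t) 0 = v.
Proof.
move=> rc; apply/cvg_lim => //.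
have e : (fun h : R => v + h *: r h) @ 0^' --> v.
  rewrite -[X in _ --> X]addr0 -[X in _ --> _ + X](scale0r (r 0)).
  apply: cvgD; first exact: cvg_cst.
  apply: cvgZ; first exact: cvg_within.
  by apply: cvg_trans rc; apply: cvg_app; exact: cvg_within.
apply: cvg_trans e; apply: near_eq_cvg; near=> h.
have h0 : h != 0 by near: h; exact: nbhs_dnbhs_neq.
rewrite addr0 scale0r expr0n scale0r !addr0 -[p + _ + _]addrA [p + _]addrC addrK.
rewrite scalerDr !scalerA.
by rewrite mulVf // scale1r expr2 mulKf.
Unshelve. all: by end_near. Qed.

(** * The manifold M_kappa and its tangent spaces *)

Section PhaseSpace.
Context {R : realType} {k l : nat} (J : 'I_(k + l) -> R) (kappa : R).
Hypotheses (J_neq0 : forall i, J i != 0) (kappa_gt0 : 0 < kappa).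
Local Notation pt := 'rV[R]_(k + l + (k + l)).
Local Notation M := (M_kappa J kappa).
Local Notation mom := (mom J).
Implicit Types (p v x : pt).

Lemma Jpow_comp e f (x : 'rV[R]_(k + l)) : Jpow J e (Jpow J f x) = Jpow J (e + f) x.
Proof. by apply/rowP => i; rewrite !mxE mulrA expfzDr. Qed.

Lemma Jpow0 (x : 'rV[R]_(k + l)) : Jpow J 0 x = x.
Proof. by apply/rowP => i; rewrite !mxE expr0z mul1r. Qed.

Lemma JpowK (x : 'rV[R]_(k + l)) : Jpow J (-1) (Jpow J 1 x) = x.
Proof. by rewrite Jpow_comp addNr Jpow0. Qed.

Lemma JpowVK (x : 'rV[R]_(k + l)) : Jpow J 1 (Jpow J (-1) x) = x.
Proof. by rewrite Jpow_comp subrr Jpow0. Qed.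

Lemma ptP x y : qpart x = qpart y -> Qpart x = Qpart y -> x = y.
Proof. by move=> qxy Qxy; rewrite -[x]hsubmxK -[y]hsubmxK; congr row_mx. Qed.

Lemma M_neq0 x : M x -> pseudo_dot (qpart x) (mom x) != 0.
Proof. by case=> _ []; rewrite /mom => ->; rewrite ?oppr_eq0 gt_eqF. Qed.

Lemma M_sqr x : M x -> pseudo_dot (qpart x) (mom x) ^+ 2 = kappa ^+ 2.
Proof. by case=> _ []; rewrite /mom => ->; rewrite ?sqrrN. Qed.

Lemma M_q_neq0 x : M x -> qpart x != 0.
Proof. by move/M_neq0; apply: contra => /eqP ->; rewrite dot0l. Qed.

Lemma M_Q_neq0 x : M x -> Qpart x != 0.
Proof.
by move/M_neq0; apply: contra => /eqP Q0; rewrite /mom Q0 -Jpow_dot dot0r.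
Qed.

Definition tangent_cond p v :=
  [/\ pseudo_dot (qpart p) (qpart v) = 0,
      pseudo_dot (Qpart p) (Qpart v) = 0 &
      pseudo_dot (qpart v) (mom p) + pseudo_dot (qpart p) (mom v) = 0].

Lemma is_derive_qq p v : is_derive p v (fun x => pseudo_dot (qpart x) (qpart x))
  (2 * pseudo_dot (qpart p) (qpart v)).
Proof.
apply: is_derive_eq (is_derive_dot (is_derive_qpart p v) (is_derive_qpart p v)) _.
by rewrite dotC; ring.
Qed.

Lemma is_derive_QQ p v : is_derive p v (fun x => pseudo_dot (Qpart x) (Qpart x))
  (2 * pseudo_dot (Qpart p) (Qpart v)).
Proof.
apply: is_derive_eq (is_derive_dot (is_derive_Qpart p v) (is_derive_Qpart p v)) _.
by rewrite dotC; ring.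
Qed.

Lemma is_derive_qmom2 p v :
  is_derive p v (fun x => pseudo_dot (qpart x) (mom x) ^+ 2 - kappa ^+ 2)
  (2 * pseudo_dot (qpart p) (mom p)
     * (pseudo_dot (qpart v) (mom p) + pseudo_dot (qpart p) (mom v))).
Proof.
have h := is_derive_dot (is_derive_qpart p v) (is_derive_mom J p v).
apply: is_derive_eq (is_deriveB (is_deriveM h h) (is_derive_cst (kappa ^+ 2) p v)) _.
by rewrite subr0 /GRing.scale /=; ring.
Qed.

Lemma smooth_mom (U : set pt) : open U -> smooth U mom.
Proof. by move=> oU; apply: smooth_Jpow => //; exact: smooth_Qpart. Qed.

(** Squaring the last equation covers both signs of kappa at once; it stays regular because its
    derivative carries the factor 2 <q, P>, nonzero on M. *)
Definition constraints x : 'rV[R]_3 := \row_i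
  [:: pseudo_dot (qpart x) (qpart x); pseudo_dot (Qpart x) (Qpart x);
      pseudo_dot (qpart x) (mom x) ^+ 2 - kappa ^+ 2]`_i.

Lemma smooth_constraints (U : set pt) : open U -> smooth U constraints.
Proof.
move=> oU; have qs := smooth_qpart oU; have Qs := smooth_Qpart oU.
have Ps := smooth_mom oU.
have s0 := smooth_dot oU qs qs; have s1 := smooth_dot oU Qs Qs.
have s2 := smoothB oU (smoothM oU (smooth_dot oU qs Ps) (smooth_dot oU qs Ps))
   (smooth_cst U (kappa ^+ 2)).
apply: smooth_row => // i.
case: i => [[|[|[|i]]] Hi] //.
- by apply: (smooth_ext oU _ s0) => x _; rewrite mxE.
- by apply: (smooth_ext oU _ s1) => x _; rewrite mxE.
- by apply: (smooth_ext oU _ s2) => x _; rewrite mxE.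
Qed.

Lemma derive_constraints p v : 'D_v constraints p = \row_i
  [:: 2 * pseudo_dot (qpart p) (qpart v); 2 * pseudo_dot (Qpart p) (Qpart v);
      2 * pseudo_dot (qpart p) (mom p)
     * (pseudo_dot (qpart v) (mom p) + pseudo_dot (qpart p) (mom v))]`_i.
Proof.
rewrite derive_mx; last first.
  apply: diff_derivable; apply: (smooth_differentiable (smooth_constraints openT)).
  by [].
apply/rowP => i; rewrite !mxE.
have e (f g : pt -> R) : (forall x, f x = g x) -> 'D_v f p = 'D_v g p.
  by move=> /funext ->.
have h0 := is_derive_qq p v; have h1 := is_derive_QQ p v.
have h2 := is_derive_qmom2 p v.
case: i => [[|[|[|i]]] Hi] //=.
- by rewrite -(derive_val (is_derive := h0)); apply: e => x; rewrite mxE.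
- by rewrite -(derive_val (is_derive := h1)); apply: e => x; rewrite mxE.
- by rewrite -(derive_val (is_derive := h2)); apply: e => x; rewrite mxE.
Qed.

Lemma M_constraints x : pseudo_dot (qpart x) (Jpow J (-1) (Qpart x)) != 0 ->
  M x <-> constraints x = 0.
Proof.
move=> x0; split=> [Mx|c0].
  have [[[qq QQ] _] _] := Mx; have ss := M_sqr Mx.
  apply/rowP; case=> [[|[|[|i]]] Hi] //; rewrite !mxE //=.
  by rewrite ss subrr.
have c0i (i : 'I_3) : constraints x 0 i = 0 by rewrite c0 mxE.
split.
  split => //; split.
    by have := c0i (@Ordinal 3 0 isT); rewrite mxE.
  by have := c0i (@Ordinal 3 1 isT); rewrite mxE.
have := c0i (@Ordinal 3 2 isT); rewrite mxE /= => /eqP; rewrite subr_eq0 eqf_sqr.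
by case/orP => /eqP; [left|right].
Qed.

Lemma embedded_M d : (d + 3)%N = (k + l + (k + l))%N -> embedded_submanifold d M.
Proof.
move=> dE p Mp.
pose U : set pt := [set x | setT x /\ pseudo_dot (qpart x) (Jpow J (-1) (Qpart x)) != 0].
have oU : open U.
  apply: smooth_open_neq0; first exact: openT.
  apply: smooth_dot; first exact: openT.
    exact/smooth_qpart/openT.
  apply: smooth_Jpow; first exact: openT.
  exact/smooth_Qpart/openT.
exists 3%N, U, constraints; split => //.
- by split => //; case: Mp => -[].
- exact: smooth_constraints.
split=> [x [_ x0]|x [_ x0] Mx w]; first exact: M_constraints.
have [[[qq QQ] _] _] := Mx; have s0 := M_neq0 Mx.
have q2 := dot_tauv_gt0 (M_q_neq0 Mx); have Q2 := dot_tauv_gt0 (M_Q_neq0 Mx).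
set q := qpart x in qq s0 q2; set Q := Qpart x in QQ Q2.
(* [tauv q] and [tauv Q] adjust the first two constraints. The multiple g of q then adjusts the
   third alone, as <q, q> = 0. *)
pose b := w 0 ord0 / (2 * pseudo_dot q (tauv q)).
pose d' := w 0 (@Ordinal 3 1 isT) / (2 * pseudo_dot Q (tauv Q)).
pose y := w 0 (@Ordinal 3 2 isT) / (2 * pseudo_dot q (mom x)).
pose g := (y - b * pseudo_dot (tauv q) (mom x) - d' * pseudo_dot q (Jpow J 1 (tauv Q)))
   / pseudo_dot q (mom x).
exists (row_mx (b *: tauv q + g *: q) (d' *: tauv Q)).
rewrite derive_constraints; apply/rowP => i; rewrite mxE /mom /qpart /Qpart.
rewrite row_mxKl row_mxKr -/(qpart x) -/(Qpart x) -/q -/Q -/(mom x).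
rewrite !(JpowE, dotE) (qq : pseudo_dot q q = 0).
have q2' := lt0r_neq0 q2; have Q2' := lt0r_neq0 Q2.
case: i => [[|[|[|i]]] Hi] //=.
- rewrite mulr0 addr0 /b (_ : Ordinal Hi = ord0); last exact: val_inj.
  by field.
- rewrite /d' (_ : Ordinal Hi = @Ordinal 3 1 isT); last exact: val_inj.
  by field.
- rewrite /g /y (_ : Ordinal Hi = @Ordinal 3 2 isT); last exact: val_inj.
  by field.
Qed.

Lemma tangent_tangent_cond p v : M p -> tangent M p v -> tangent_cond p v.
Proof.
move=> Mp tv.
have c0 : 'D_v constraints p = 0.
  apply: (tangent_derive0 (smooth_constraints openT) _ tv) => x Mx.
  by apply/M_constraints => //; case: Mx => -[].
have s0 := M_neq0 Mp.
have c0i (i : 'I_3) : 'D_v constraints p 0 i = 0 by rewrite c0 mxE.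
rewrite derive_constraints in c0i.
have two0 : (2 : R) != 0 by rewrite pnatr_eq0.
split.
- have := c0i (@Ordinal 3 0 isT); rewrite mxE /= => /eqP.
  by rewrite mulf_eq0 (negbTE two0) => /eqP.
- have := c0i (@Ordinal 3 1 isT); rewrite mxE /= => /eqP.
  by rewrite mulf_eq0 (negbTE two0) => /eqP.
- have := c0i (@Ordinal 3 2 isT); rewrite mxE /= => /eqP.
  by rewrite !mulf_eq0 (negbTE two0) (negbTE s0) => /eqP.
Qed.

Lemma smooth_param (U : set R^o) : smooth U (fun t : R^o => t : R).
Proof. by apply: smooth_lin => // x; exact: cvg_id. Qed.

(* The straight line p + t v is corrected to second order: along tau q and tau Q,
   which are light-like, to return to the cones, then by rescaling Q to restore
   the value of <q, J Q>. *)
Lemma tangent_cond_tangent p v : M p -> tangent_cond p v -> tangent M p v.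
Proof.
move=> Mp; rewrite /tangent_cond; set u := qpart v; set w := Qpart v.
have [[[qq QQ] qJQ] sk] := Mp; have s0 := M_neq0 Mp.
have q2 := dot_tauv_gt0 (M_q_neq0 Mp); have Q2 := dot_tauv_gt0 (M_Q_neq0 Mp).
rewrite /mom; set q := qpart p in qq qJQ sk s0 q2 *; set Q := Qpart p in QQ qJQ sk s0 Q2 *.
set s := pseudo_dot q (Jpow J 1 Q) in sk.
case=> qu Qw uw.
pose d1 (t : R^o) : R := pseudo_dot q (tauv q) + t * pseudo_dot u (tauv q).
pose d2 (t : R^o) : R := pseudo_dot Q (tauv Q) + t * pseudo_dot w (tauv Q).
(* Since <q,q> = <q,u> = 0 and [tauv q] is light-like, <qh, qh> = 0 becomes, after division by t^2,
   an equation linear in y1 with slope 2 d1; likewise for y2. *)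
pose y1 (t : R^o) : R := - pseudo_dot u u / (2 * d1 t).
pose y2 (t : R^o) : R := - pseudo_dot w w / (2 * d2 t).
pose qh (t : R^o) := q + t *: u + (t ^+ 2 * y1 t) *: tauv q.
pose Qh (t : R^o) := Q + t *: w + (t ^+ 2 * y2 t) *: tauv Q.
(* In <qh, J Qh> = s + t^2 rho the term of order t cancels by the third tangency condition. Hence
   rescaling Qh by s / d3 is again a second-order correction. *)
pose rho (t : R^o) : R := pseudo_dot u (Jpow J 1 w)
  + y1 t * pseudo_dot (tauv q) (Jpow J 1 (Q + t *: w))
  + y2 t * pseudo_dot (q + t *: u) (Jpow J 1 (tauv Q))
  + t ^+ 2 * y1 t * y2 t * pseudo_dot (tauv q) (Jpow J 1 (tauv Q)).
pose d3 (t : R^o) : R := s + t ^+ 2 * rho t.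
have d3E t : pseudo_dot (qh t) (Jpow J 1 (Qh t)) = d3 t.
  rewrite /qh /Qh /d3 /rho !(JpowE, dotE) -/s.
  have -> : pseudo_dot u (Jpow J 1 Q) = - pseudo_dot q (Jpow J 1 w).
    by apply/eqP; rewrite -addr_eq0 uw.
  ring.
pose d4 (t : R^o) : R := pseudo_dot (qh t) (Jpow J (-1) (Qh t)).
have st (U : set R^o) := smooth_param U.
have sd1 : smooth setT d1.
  apply: (smoothD openT); first exact: smooth_cst.
  by apply: (smoothM openT (st _)); exact: smooth_cst.
have sd2 : smooth setT d2.
  apply: (smoothD openT); first exact: smooth_cst.
  by apply: (smoothM openT (st _)); exact: smooth_cst.
have [d10 d20] : d1 0 != 0 /\ d2 0 != 0.
  by rewrite /d1 /d2 !mul0r !addr0 !lt0r_neq0.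
pose I1 : set R^o := [set t | setT t /\ d1 t != 0].
have oI1 : open I1 by apply: smooth_open_neq0 => //; exact: openT.
pose I2 : set R^o := [set t | I1 t /\ d2 t != 0].
have oI2 : open I2 by apply: smooth_open_neq0 => //; exact: smooth_sub sd2.
have I21 t : I2 t -> d1 t != 0 by case=> -[].
have sy1 : smooth I2 y1.
  apply: (smoothM oI2); first exact: smooth_cst.
  apply: smoothV => //; first by move=> t /I21 ?; apply: mulf_neq0; rewrite ?pnatr_eq0.
  by apply: (smoothM oI2); [exact: smooth_cst|exact: smooth_sub sd1].
have sy2 : smooth I2 y2.
  apply: (smoothM oI2); first exact: smooth_cst.
  apply: smoothV => //; first by move=> t [_ ?]; apply: mulf_neq0; rewrite ?pnatr_eq0.
  by apply: (smoothM oI2); [exact: smooth_cst|exact: smooth_sub sd2].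
have st2 : smooth I2 (fun t : R^o => t ^+ 2 : R) by exact: smoothM.
have sqh : smooth I2 qh.
  apply: smoothD => //; last by apply: smoothZl => //; exact: smoothM.
  by apply: smoothD => //; [exact: smooth_cst|exact: smoothZl].
have sQh : smooth I2 Qh.
  apply: smoothD => //; last by apply: smoothZl => //; exact: smoothM.
  by apply: smoothD => //; [exact: smooth_cst|exact: smoothZl].
have srho : smooth I2 rho.
  apply: smoothD => //; last first.
    by apply: smoothM => //; [do 2!apply: smoothM => //|exact: smooth_cst].
  apply: smoothD => //; last first.
    apply: smoothM => //; apply: smooth_dot => //; last exact: smooth_cst.
    by apply: smoothD => //; [exact: smooth_cst|exact: smoothZl].
  apply: smoothD => //; first exact: smooth_cst.
  apply: smoothM => //; apply: smooth_dot => //; first exact: smooth_cst.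
  apply: smooth_Jpow => //.
  by apply: smoothD => //; [exact: smooth_cst|exact: smoothZl].
have sd3 : smooth I2 d3.
  by apply: smoothD => //; [exact: smooth_cst|exact: smoothM].
have sd4 : smooth I2 d4 by apply: smooth_dot => //; exact: smooth_Jpow.
pose I3 : set R^o := [set t | I2 t /\ d3 t != 0].
have oI3 : open I3 by exact: smooth_open_neq0.
pose I4 : set R^o := [set t | I3 t /\ d4 t != 0].
have oI4 : open I4.
  by apply: smooth_open_neq0 => //; apply: smooth_sub sd4 => t [].
have I42 : I4 `<=` I2 by move=> t [[]].
pose r (t : R^o) : pt := row_mx (y1 t *: tauv q)
   (y2 t *: tauv Q - (rho t / d3 t) *: Qh t).
have sr : smooth I4 r.
  apply: smooth_row_mx => //.
    by apply: smoothZl => //; exact: smooth_sub sy1.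
  apply: smoothD => //; first by apply: smoothZl => //; exact: smooth_sub sy2.
  apply: smooth_rowN => //; apply: smooth_rowZ => //; last exact: smooth_sub sQh.
  apply: smoothM => //; first exact: smooth_sub srho.
  apply: smoothV => //; last exact: smooth_sub sd3.
  by move=> t [[]].
pose c (t : R^o) : pt := p + t *: v + t ^+ 2 *: r t.
have I40 : I4 0.
  split; [split; [by []|]|].
    by rewrite /d3 expr0n mul0r addr0.
  by rewrite /d4 /qh /Qh !scale0r expr0n !mul0r !scale0r !addr0.
have qc t : qpart (c t) = qh t.
  rewrite /c /qpart !linearD !linearZ /= row_mxKl -!/(qpart _) -/q -/u.
  by rewrite scalerA.
have Qc t : d3 t != 0 -> Qpart (c t) = (s / d3 t) *: Qh t.
  move=> d30; have -> : Qpart (c t) = Qh t - (t ^+ 2 * (rho t / d3 t)) *: Qh t.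
    have -> : Qpart (c t) = Q + t *: w + t ^+ 2 *: Qpart (r t).
      by rewrite /c /Qpart !linearD !linearZ.
    by rewrite /Qpart row_mxKr scalerBr !scalerA addrA.
  rewrite -[X in X - _]scale1r -scalerBl; congr (_ *: _).
  by apply: (mulIf d30); rewrite mulrBl mul1r mulrA !divfK // /d3; ring.
exists I4, c; split => //.
- apply: smoothD => //; last by apply: smooth_rowZ => //; exact: smooth_sub st2.
  by apply: smoothD => //; [exact: smooth_cst|exact: smoothZl].
- move=> t It; have [[[[_ d1t] d2t] d3t] d4t] := It.
  split; [split; [split|]|].
  + rewrite /light_cone /= qc /qh !dotE dot_tauv (qq : pseudo_dot q q = 0).
    rewrite (dotC u q) qu (dotC (tauv q) q) (dotC (tauv q) u) /y1.
    have -> : pseudo_dot q (tauv q) = d1 t - t * pseudo_dot u (tauv q).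
      by rewrite /d1 addrK.
    by field.
  + rewrite /light_cone /= Qc // dotZl dotZr /Qh !dotE dot_tauv (QQ : pseudo_dot Q Q = 0).
    rewrite (dotC w Q) Qw (dotC (tauv Q) Q) (dotC (tauv Q) w) /y2.
    have -> : pseudo_dot Q (tauv Q) = d2 t - t * pseudo_dot w (tauv Q).
      by rewrite /d2 addrK.
    by field; rewrite d2t d3t.
  + rewrite /= qc Qc // JpowZ dotZr -/(d4 t); do ?apply: mulf_neq0 => //.
    by rewrite invr_eq0.
  + by rewrite /= qc Qc // JpowZ dotZr d3E divfK.
- split; first by rewrite /c scale0r expr0n scale0r !addr0.
  by apply: derive1_second_order; exact: smooth_continuous sr I40.
Qed.

Lemma tangentP p v : M p -> tangent M p v <-> tangent_cond p v.
Proof.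
by move=> Mp; split; [exact: tangent_tangent_cond|exact: tangent_cond_tangent].
Qed.

End PhaseSpace.

(** * Contact geometry of M_kappa *)

Section Contact.
Context {R : realType} {k l : nat} (J : 'I_(k + l) -> R) (kappa : R).
Hypotheses (J_neq0 : forall i, J i != 0)
  (J_sqr : forall i j, i != j -> J i ^+ 2 != J j ^+ 2)
  (kappa_gt0 : 0 < kappa).
Local Notation pt := 'rV[R]_(k + l + (k + l)).
Local Notation M := (M_kappa J kappa).
Local Notation mom := (mom J).
Local Notation heis_integral := (heis_integral J).
Local Notation xrot := (xrot J).
Implicit Types (p u v x : pt).

(** In the variables (q, P) alpha is the Liouville form <P, dq>. *)
Lemma alphaE x v : alpha J x v = pseudo_dot (mom x) (qpart v).
Proof. by apply: eq_bigr => i _; rewrite [mom _ _ _]mxE mulrA. Qed.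

Lemma qpartP (a : R) u v : qpart (a *: u + v) = a *: qpart u + qpart v.
Proof. by rewrite /qpart linearP. Qed.

Lemma QpartP (a : R) u v : Qpart (a *: u + v) = a *: Qpart u + Qpart v.
Proof. by rewrite /Qpart linearP. Qed.

Lemma momP (a : R) u v : mom (a *: u + v) = a *: mom u + mom v.
Proof. by rewrite /mom QpartP !JpowE. Qed.

Lemma smooth_alpha v (U : set pt) : open U -> smooth U (alpha J ^~ v).
Proof.
move=> oU; apply: (@smooth_ext _ _ _ _ (fun x => pseudo_dot (mom x) (qpart v))) => //.
  by move=> x _; rewrite alphaE.
by apply: smooth_dot => //; [exact: smooth_mom|exact: smooth_cst].
Qed.

Lemma one_form_alpha : one_form (alpha J).
Proof.
split=> [p s u v|v]; last exact/smooth_alpha/openT.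
by rewrite !alphaE qpartP !dotE.
Qed.

Lemma dform_alpha p u v :
  dform (alpha J) p u v = pseudo_dot (mom u) (qpart v) - pseudo_dot (mom v) (qpart u).
Proof.
have D w w' : 'D_w (alpha J ^~ w') p = pseudo_dot (mom w) (qpart w').
  rewrite derive_lin ?alphaE //.
    by move=> a x y; rewrite !alphaE momP !dotE.
  by move=> x; apply: (smooth_continuous (smooth_alpha w' openT)).
by rewrite /dform !D.
Qed.

Lemma qpart_row (a b : 'rV[R]_(k + l)) : qpart (row_mx a b) = a.
Proof. by rewrite /qpart row_mxKl. Qed.

Lemma Qpart_row (a b : 'rV[R]_(k + l)) : Qpart (row_mx a b) = b.
Proof. by rewrite /Qpart row_mxKr. Qed.

Lemma mom_row (a b : 'rV[R]_(k + l)) : mom (row_mx a b) = Jpow J 1 b.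
Proof. by rewrite /mom Qpart_row. Qed.

Definition part_rowE := (qpart_row, Qpart_row, mom_row).

Lemma M_light x : M x ->
  pseudo_dot (qpart x) (qpart x) = 0 /\ pseudo_dot (Qpart x) (Qpart x) = 0.
Proof. by case=> [[[]]]. Qed.

Lemma M_qJVQ_neq0 x : M x -> pseudo_dot (qpart x) (Jpow J (-1) (Qpart x)) != 0.
Proof. by case=> [[]]. Qed.

Lemma Qpart_mom x : Qpart x = Jpow J (-1) (mom x).
Proof. by rewrite /mom JpowK. Qed.

(** The generator of the scaling (exp(t) q, exp(-t) Q), normalised to have value 1 under alpha. *)
Definition reeb x : pt :=
  (pseudo_dot (qpart x) (mom x))^-1 *: row_mx (qpart x) (- Qpart x).

Lemma reeb_row x : reeb x =
  row_mx ((pseudo_dot (qpart x) (mom x))^-1 *: qpart x)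
         (- (pseudo_dot (qpart x) (mom x))^-1 *: Qpart x).
Proof. by rewrite /reeb scale_row_mx scalerN scaleNr. Qed.

Lemma reeb_tangent x : M x -> tangent M x (reeb x).
Proof.
move=> Mx; apply/tangentP => //; have [qq QQ] := M_light Mx.
by rewrite reeb_row; split; rewrite !part_rowE ?JpowE !dotE ?qq ?QQ ?mulr0 // -/(mom x); ring.
Qed.

Lemma alpha_reeb x : M x -> alpha J x (reeb x) = 1.
Proof.
by move=> /(M_neq0 kappa_gt0) s0; rewrite alphaE reeb_row part_rowE dotZr (dotC (mom x)) mulVf.
Qed.

Lemma dform_reeb x v : M x -> tangent_cond J x v -> dform (alpha J) x (reeb x) v = 0.
Proof.
move=> Mx [_ _ h]; rewrite dform_alpha reeb_row !part_rowE JpowE !dotE -/(mom x).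
rewrite (dotC (mom x)) (dotC (mom v)).
by move/eqP: h; rewrite addr_eq0 => /eqP ->; ring.
Qed.

Lemma open_nondegenerate : open [set x | setT x /\ pseudo_dot (qpart x) (mom x) != 0 ] /\
  open [set x | ([set x : pt | setT x /\ pseudo_dot (qpart x) (mom x) != 0 ] x) /\
     pseudo_dot (qpart x) (Jpow J (-1) (Qpart x)) != 0].
Proof.
have oT := @openT pt.
have s1 : smooth setT (fun x : pt => pseudo_dot (qpart x) (mom x)).
  by apply: smooth_dot => //; [exact: smooth_qpart|exact: smooth_mom].
have o1 := smooth_open_neq0 oT s1.
split => //; apply: smooth_open_neq0 => //.
by apply: smooth_dot => //; [exact: smooth_qpart|apply: smooth_Jpow => //; exact: smooth_Qpart].
Qed.

Lemma smooth_reeb : smooth_on M setT reeb.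
Proof.
move=> p Mp _; exists reeb; have [oU _] := open_nondegenerate.
apply: (smooth_local_extension M oU); last by split => //; exact: (M_neq0 kappa_gt0).
apply: smooth_rowZ => //.
  apply: smoothV => //; first by move=> x [].
  by apply: smooth_dot => //; [exact: smooth_qpart|exact: smooth_mom].
apply: smooth_row_mx => //; first exact: smooth_qpart.
by apply: smooth_rowN => //; exact: smooth_Qpart.
Qed.

Lemma is_reeb_reeb : is_reeb M (alpha J) reeb.
Proof.
split; first by split; [exact: smooth_reeb|exact: reeb_tangent].
  exact: alpha_reeb.
by move=> p v Mp /(tangentP kappa_gt0 v Mp); exact: dform_reeb.
Qed.

(** Test vectors (v, 0) confine the momentum part of u to the plane of q and P, and test vectors (0,
    v) confine its q part to the plane of J^-1 Q and q. The tangency conditions and alpha(u) = 0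
    then kill the four coefficients, by <q, P> != 0 and <q, J^-1 Q> != 0. *)
Lemma contact_form_alpha : contact_form M (alpha J).
Proof.
split; first exact: one_form_alpha.
  by move=> p Mp; exists (reeb p); [exact: reeb_tangent|rewrite alpha_reeb ?oner_neq0].
move=> p u Mp /(tangentP kappa_gt0 u Mp) [qu Qu cu] au0 du.
have [qq QQ] := M_light Mp; have s0 := M_neq0 kappa_gt0 Mp; have j0 := M_qJVQ_neq0 Mp.
set q := qpart p in qu cu qq s0 j0 *; set Q := Qpart p in Qu QQ j0.
have [c1 [c2 e1]] : exists a b, mom u = a *: q + b *: mom p.
  apply: dot_span => // v qv Pv.
  have := du (row_mx v 0); rewrite dform_alpha !part_rowE JpowE dot0l subr0; apply.
    apply/tangentP => //; split; rewrite !part_rowE -/q -/Q ?dot0r //.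
    by rewrite JpowE dot0r addr0 dotC.
  by rewrite alphaE part_rowE.
have [d1 [d2 e2]] : exists a b, qpart u = a *: Jpow J (-1) Q + b *: q.
  have [d1 [d2 e2]] : exists a b, Jpow J 1 (qpart u) = a *: Q + b *: Jpow J 1 q.
    apply: dot_span => //; first by rewrite -Jpow_dot dotC.
    move=> v Qv qv; have := du (row_mx 0 v).
    rewrite dform_alpha !part_rowE dot0r sub0r (dotC (Jpow J 1 v)) -Jpow_dot => h.
    apply/eqP; rewrite -oppr_eq0; apply/eqP; apply: h.
      apply/tangentP => //; split; rewrite !part_rowE -/q -/Q ?dot0r ?dot0l //.
      by rewrite add0r -Jpow_dot.
    by rewrite alphaE part_rowE dot0r.
  exists d1, d2; rewrite -[LHS](JpowK J_neq0) e2 !JpowE.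
  by rewrite (JpowK J_neq0).
have d10 : d1 = 0.
  move: qu; rewrite e2 !dotE qq mulr0 addr0 => /eqP.
  by rewrite mulf_eq0 (negbTE j0) orbF => /eqP.
have d20 : d2 = 0.
  move: au0; rewrite alphaE e2 d10 scale0r add0r dotZr dotC => /eqP.
  by rewrite mulf_eq0 (negbTE s0) orbF => /eqP.
have u1 : qpart u = 0 by rewrite e2 d10 d20 !scale0r addr0.
have Qe : Qpart u = c1 *: Jpow J (-1) q + c2 *: Q.
  by rewrite Qpart_mom e1 !JpowE -Qpart_mom.
have c10 : c1 = 0.
  move: Qu; rewrite Qe !dotE QQ mulr0 addr0 -Jpow_dot dotC => /eqP.
  by rewrite mulf_eq0 (negbTE j0) orbF => /eqP.
have c20 : c2 = 0.
  move: cu; rewrite u1 dot0l add0r e1 c10 scale0r add0r dotZr => /eqP.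
  by rewrite mulf_eq0 (negbTE s0) orbF => /eqP.
by apply: ptP; [rewrite u1|rewrite Qe c10 c20 !scale0r addr0]; rewrite /qpart /Qpart linear0.
Qed.

(* [a] and [c] make the field tangent to the cone of Q and give it the value
   [heis_integral i x] under alpha. *)
Definition ham_field i x : pt :=
  let q := qpart x in let Q := Qpart x in
  let c := - heis_integral i x / pseudo_dot q (mom x) in
  let a := - (2 * pseudo_dot Q (Jpow J (-1) (xrot i x (mom x))))
             / pseudo_dot q (Jpow J (-1) Q) in
  row_mx (2 *: xrot i x q + c *: q)
         (Jpow J (-1) (2 *: xrot i x (mom x) + a *: q - c *: mom x)).

Lemma smooth_xrot i (U : set pt) (f : pt -> 'rV[R]_(k + l)) : open U ->
  smooth U f -> smooth U (fun x => xrot i x (f x)).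
Proof.
move=> oU fs.
apply: (@smooth_ext _ _ _ _ (fun x => rotation J (qpart x) (mom x) i (f x))) => //.
  by move=> x _; rewrite xrotE.
have sq j := smooth_row_coord j oU (smooth_qpart oU).
have sP j := smooth_row_coord j oU (smooth_mom J oU).
have sm : smooth U (fun x => moment_row J (qpart x) (mom x) i).
  apply: smooth_row => // j.
  apply: (@smooth_ext _ _ _ _ (fun x =>
    moment (qpart x) (mom x) i j / (J i ^+ 2 - J j ^+ 2))) => //.
    by move=> x _; rewrite [RHS]mxE.
  apply: smoothM => //; last exact: smooth_cst.
  by apply: smoothB => //; exact: smoothM.
apply: smoothD => //.
  by apply: smooth_rowZ => //; exact: smooth_row_coord.
apply: smooth_rowN => //; apply: smoothZl => //.
by apply: smoothM => //; [exact: smooth_cst|exact: smooth_dot].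
Qed.

Lemma smooth_ham_field i : smooth_on M setT (ham_field i).
Proof.
move=> p Mp _; exists (ham_field i); have [_ oU] := open_nondegenerate.
apply: (smooth_local_extension M oU); last first.
  by split; [split => //; exact: (M_neq0 kappa_gt0)|exact: M_qJVQ_neq0].
set U := [set x | _] in oU *.
have sq := smooth_qpart oU; have sQ := smooth_Qpart oU; have sP := smooth_mom J oU.
have sc : smooth U (fun x => - heis_integral i x / pseudo_dot (qpart x) (mom x)).
  apply: smoothM => //; first by apply: smoothN => //; exact: smooth_integral.
  by apply: smoothV => //; [move=> x [[]]|exact: smooth_dot].
have sa : smooth U (fun x => - (2 * pseudo_dot (Qpart x) (Jpow J (-1) (xrot i x (mom x))))
             / pseudo_dot (qpart x) (Jpow J (-1) (Qpart x))).
  apply: smoothM => //.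
    apply: smoothN => //; apply: smoothM => //; first exact: smooth_cst.
    apply: smooth_dot => //; apply: smooth_Jpow => //; exact: smooth_xrot.
  by apply: smoothV => //; [move=> x []|apply: smooth_dot => //; exact: smooth_Jpow].
have s2 (f : pt -> 'rV[R]_(k + l)) : smooth U f -> smooth U (fun x => 2 *: f x).
  by move=> fs; apply: smooth_rowZ => //; exact: smooth_cst.
apply: smooth_row_mx => //.
  apply: smoothD => //; last exact: smooth_rowZ.
  by apply: s2; exact: smooth_xrot.
apply: smooth_Jpow => //; apply: smoothD => //; last first.
  by apply: smooth_rowN => //; exact: smooth_rowZ.
apply: smoothD => //; last exact: smooth_rowZ.
by apply: s2; exact: smooth_xrot.
Qed.

Lemma qpart_ham i x : qpart (ham_field i x) = 2 *: xrot i x (qpart x)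
  + (- heis_integral i x / pseudo_dot (qpart x) (mom x)) *: qpart x.
Proof. by rewrite part_rowE. Qed.

(** The coefficient of q stays anonymous: wherever the lemma is used it multiplies <q, q>, <q, dq>
    or <[xrot] q, q>, all zero. *)
Lemma mom_ham i x : exists a, mom (ham_field i x) = 2 *: xrot i x (mom x)
  + a *: qpart x + (heis_integral i x / pseudo_dot (qpart x) (mom x)) *: mom x.
Proof.
eexists; rewrite mom_row (JpowVK J_neq0) (mulNr (heis_integral i x)) scaleNr opprK.
by reflexivity.
Qed.

Lemma xrot_mom i x : pseudo_dot (xrot i x (qpart x)) (mom x) = heis_integral i x.
Proof. by rewrite xrotE rotation_momentum. Qed.

Lemma xrot_mom' i x : pseudo_dot (xrot i x (mom x)) (qpart x) = - heis_integral i x.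
Proof. by rewrite xrotE rotation_antisym -xrotE xrot_mom. Qed.

Lemma xrot_dotxx i x y : pseudo_dot (xrot i x y) y = 0.
Proof. by rewrite xrotE rotation_dotxx. Qed.

Lemma xrot_commute i j x : pseudo_dot (xrot j x (qpart x)) (xrot i x (mom x)) =
  pseudo_dot (xrot j x (mom x)) (xrot i x (qpart x)).
Proof. by rewrite !xrotE rotation_commute. Qed.

Lemma ham_tangent_cond i x : M x -> tangent_cond J x (ham_field i x).
Proof.
move=> Mx; have [qq QQ] := M_light Mx.
have s0 := M_neq0 kappa_gt0 Mx; have j0 := M_qJVQ_neq0 Mx.
split.
- by rewrite qpart_ham !dotE qq (dotC (qpart x) (xrot _ _ _)) xrot_dotxx; ring.
- rewrite /ham_field Qpart_row !(JpowE, dotE) -Qpart_mom QQ mulr0 oppr0 addr0.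
  by rewrite (dotC (Qpart x) (Jpow J (-1) (qpart x))) Jpow_dot; field.
- have [a ->] := mom_ham i x.
  rewrite qpart_ham !dotE qq xrot_mom (dotC (qpart x) (xrot _ _ _)) xrot_mom'.
  by ring.
Qed.

Lemma alpha_ham i x : M x -> alpha J x (ham_field i x) = heis_integral i x.
Proof.
move=> /(M_neq0 kappa_gt0) s0.
rewrite alphaE qpart_ham !dotE (dotC (mom x)) xrot_mom (dotC (mom x)).
by field.
Qed.

Lemma dform_ham i x v : M x -> tangent_cond J x v ->
  dform (alpha J) x (ham_field i x) v = - 'D_v (heis_integral i) x.
Proof.
move=> Mx [qv _ h]; rewrite dform_alpha derive_integral.
have s0 := M_neq0 kappa_gt0 Mx.
have [a ->] := mom_ham i x; rewrite qpart_ham !dotE qv.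
rewrite !(dotC (mom v)).
move/eqP: h; rewrite addr_eq0 dotC => /eqP ->.
by ring.
Qed.

Lemma smooth_on_integral i : smooth_on M setT (heis_integral i).
Proof.
move=> p Mp _; exists (heis_integral i); exists setT; split => //; first exact: openT.
by apply: smooth_integral; exact: openT.
Qed.

Lemma mdiff_integral i x v : tangent M x v ->
  mdiff M (heis_integral i) x v = 'D_v (heis_integral i) x.
Proof.
apply: mdiffE; exists setT; split => //; first exact: openT.
by apply: smooth_integral; exact: openT.
Qed.

Lemma contact_field_ham i :
  is_contact_field_of M (alpha J) (heis_integral i) (ham_field i).
Proof.
have tangent_ham x : M x -> tangent M x (ham_field i x).
  by move=> Mx; apply/tangentP => //; exact: ham_tangent_cond.
split; last by move=> p Mp; exact: alpha_ham.
split; first by split; [exact: smooth_ham_field|exact: tangent_ham].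
(* In general L_Y alpha = (Z f) alpha for Y = Y_f; here f is constant along the Reeb field, so the
   two terms of Cartan's formula cancel. *)
exists (fun=> 0).
  move=> p _ _; exists (fun=> 0); exists setT; split => //; first exact: openT.
  exact: smooth_cst.
move=> p v Mp tv; rewrite mul0r /lie_form.
rewrite dform_ham //; last exact/(tangentP kappa_gt0).
rewrite (@mdiffE _ _ _ _ _ (heis_integral i) _ _ _ tv) ?addNr //.
exists setT; split => //; first exact: openT.
  by apply: smooth_integral; exact: openT.
by move=> x _ Mx; rewrite alpha_ham.
Qed.

Lemma lie_reeb_integral i p : M p -> lie_fun M reeb (heis_integral i) p = 0.
Proof.
move=> Mp; rewrite /lie_fun mdiff_integral; last exact: reeb_tangent.
rewrite derive_integral reeb_row !part_rowE JpowE !dotE -/(mom p) xrot_mom xrot_mom'.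
by ring.
Qed.

Lemma jacobi_bracket_integral i j p : M p ->
  jacobi_bracket M reeb (ham_field i) (heis_integral i) (heis_integral j) p = 0.
Proof.
move=> Mp; rewrite /jacobi_bracket lie_reeb_integral // mulr0 subr0 /lie_fun.
rewrite mdiff_integral; last by apply/tangentP => //; exact: ham_tangent_cond.
rewrite derive_integral qpart_ham; have [a ->] := mom_ham i p.
rewrite !dotE xrot_mom xrot_mom' xrot_commute !xrot_dotxx; ring.
Qed.

End Contact.

(** * The Heisenberg map preserves [M_kappa], alpha and the integrals *)

Section Heisenberg.
Context {R : realType} {k l : nat} (J : 'I_(k + l) -> R) (kappa : R).
Hypotheses (J_neq0 : forall i, J i != 0)
  (J_sqr : forall i j, i != j -> J i ^+ 2 != J j ^+ 2)
  (kappa_gt0 : 0 < kappa).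
Local Notation pt := 'rV[R]_(k + l + (k + l)).
Local Notation M := (M_kappa J kappa).
Local Notation D := (heis_dom J).
Local Notation mom := (mom J).
Local Notation Phi := (heis_Phi J).
Local Notation lambda := (heis_lambda J).
Implicit Types (p u v x : pt).

Lemma qpart_Phi x : qpart (Phi x) = Qpart x.
Proof. exact: qpart_row. Qed.

Lemma Qpart_Phi x : Qpart (Phi x) = lambda x *: Jpow J (-1) (Qpart x) - qpart x.
Proof. exact: Qpart_row. Qed.

Lemma mom_Phi x : mom (Phi x) = lambda x *: Qpart x - Jpow J 1 (qpart x).
Proof. by rewrite /mom Qpart_Phi !JpowE (JpowVK J_neq0). Qed.

Lemma heis_domE x : pseudo_dot (Jpow J (-2) (Qpart x)) (Qpart x) =
  pseudo_dot (Jpow J (-1) (Qpart x)) (Jpow J (-1) (Qpart x)).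
Proof. by rewrite Jpow_dot [in RHS]Jpow_dot (Jpow_comp J_neq0). Qed.

(** The line through -q in direction J^-1 Q meets the cone again exactly at the parameter lambda.
    The same value keeps <q, J^-1 Q> unchanged, while <q, J Q> changes sign, which is why M_kappa
    contains both signs of kappa. *)
Lemma Phi_M p : M p -> D p -> M (Phi p).
Proof.
move=> Mp; rewrite /heis_dom /= => Dp; have [qq QQ] := M_light Mp.
have lE : lambda p * pseudo_dot (Jpow J (-2) (Qpart p)) (Qpart p) =
    2 * pseudo_dot (qpart p) (Jpow J (-1) (Qpart p)).
  by rewrite /heis_lambda divfK // (dotC (qpart p)).
rewrite heis_domE in lE.
have j0 := M_qJVQ_neq0 Mp; have [_ sk] := Mp.
split; [split; [split|]|].
- by rewrite /light_cone /= qpart_Phi.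
- rewrite /light_cone /= Qpart_Phi !dotE qq (dotC (Jpow _ _ _) (qpart p)).
  transitivity (lambda p * (lambda p * pseudo_dot (Jpow J (-1) (Qpart p))
    (Jpow J (-1) (Qpart p)) - 2 * pseudo_dot (qpart p) (Jpow J (-1) (Qpart p)))).
    by ring.
  by rewrite lE subrr mulr0.
- rewrite /= qpart_Phi Qpart_Phi !(JpowE, dotE) -!(Jpow_dot _ _ (Qpart p)) lE.
  by rewrite (dotC _ (qpart p)) mulr_natl mulr2n addrK.
- rewrite /= qpart_Phi -/(mom (Phi p)) mom_Phi !dotE QQ mulr0 add0r.
  rewrite -Jpow_dot dotC; case: sk => ->; first by right.
  by left; rewrite opprK.
Qed.

Lemma open_heis_dom :
  open [set x : pt | setT x /\ pseudo_dot (Jpow J (-2) (Qpart x)) (Qpart x) != 0].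
Proof.
have oT := @openT pt; have sQ := smooth_Qpart oT.
by apply: smooth_open_neq0 => //; apply: smooth_dot => //; exact: smooth_Jpow.
Qed.

Lemma smooth_Phi : smooth
  [set x : pt | setT x /\ pseudo_dot (Jpow J (-2) (Qpart x)) (Qpart x) != 0] Phi.
Proof.
have oU := open_heis_dom; set U := [set x | _] in oU *.
have sq := smooth_qpart oU; have sQ := smooth_Qpart oU.
apply: smooth_row_mx => //; apply: smoothD => //; last exact: smooth_rowN.
apply: smooth_rowZ => //; last exact: smooth_Jpow.
apply: smoothM => //.
  apply: smoothM => //; first exact: smooth_cst.
  by apply: smooth_dot => //; exact: smooth_Jpow.
apply: smoothV => //; first by move=> x [].
by apply: smooth_dot => //; exact: smooth_Jpow.
Qed.

(** As the new q is Q, the derivative of lambda never enters: the pullback is <lambda Q - J q, dQ> =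
    -<q, J dQ> by <Q, dQ> = 0, and this equals <J Q, dq> because <q, J Q> is locally constant on
    M. *)
Lemma contact_map_Phi : contact_map M D (alpha J) Phi.
Proof.
have le p : D p -> local_extension M Phi p Phi.
  by move=> Dp; apply: (smooth_local_extension M open_heis_dom smooth_Phi).
split; first exact: Phi_M.
  by move=> p _ Dp; exists Phi; exact: le.
move=> p v Mp Dp tv; rewrite (mdiffE (le p Dp) tv) !alphaE.
have -> : qpart ('D_v Phi p) = Qpart v.
  have ql : linear (@qpart R (k + l)) by move=> a x y; exact: qpartP.
  have qc : continuous (@qpart R (k + l)).
    by move=> x; apply: (smooth_continuous (smooth_qpart openT)).
  rewrite -(derive_comp_lin _ ql qc); last first.
    by apply: (smooth_differentiable smooth_Phi).
  rewrite (_ : (fun y => _) = @Qpart R (k + l)); last first.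
    by apply/funext => y; exact: qpart_Phi.
  apply: derive_lin; first by move=> a x y; exact: QpartP.
  by move=> x; apply: (smooth_continuous (smooth_Qpart openT)).
have [_ Qv h] := (tangentP kappa_gt0 v Mp).1 tv.
rewrite mom_Phi !dotE Qv mulr0 add0r Jpow_dot -/(mom v) (dotC (mom p)).
by apply/esym/eqP; rewrite -addr_eq0 h.
Qed.

(** The lambda term of the new momentum is a multiple of the new q, namely Q, so it drops out of
    every m_ij; the changes add up to q_i^2 <Q,Q> - Q_i^2 <q,q>. *)
Lemma heis_integral_Phi i p : M p -> heis_integral J i (Phi p) = heis_integral J i p.
Proof.
move=> Mp; have [qq QQ] := M_light Mp.
apply/eqP; rewrite -subr_eq0; apply/eqP.
transitivity (qpart p 0 i ^+ 2 * pseudo_dot (Qpart p) (Qpart p)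
   - Qpart p 0 i ^+ 2 * pseudo_dot (qpart p) (qpart p)); last first.
  by rewrite qq QQ !mulr0 subr0.
rewrite /heis_integral /integral_form /pseudo_dot !mulr_sumr -!sumrB.
apply: eq_bigr => j _; rewrite /moment qpart_Phi mom_Phi.
have e (x y : 'rV[R]_(k + l)) (a : R) h : (a *: x - Jpow J 1 y) 0 h = a * x 0 h - J h * y 0 h.
  by rewrite !mxE expr1z.
have e' h : mom p 0 h = J h * Qpart p 0 h by rewrite [LHS]mxE expr1z.
rewrite !e !e'; have [->|ij] := eqVneq i j; first by ring.
by field; rewrite subr_eq0 J_sqr.
Qed.

End Heisenberg.

(** * Functional independence *)

Lemma smooth_prod (R : realType) (V : normedModType R) (I : Type) (r : seq I)
    (U : set V) (f : I -> V -> R) :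
  open U -> (forall i, smooth U (f i)) -> smooth U (fun x => \prod_(i <- r) f i x).
Proof.
move=> oU fs; elim: r => [|i r IH].
  by apply: (smooth_ext oU _ (smooth_cst U (1 : R))) => x _; rewrite big_nil.
apply: (smooth_ext oU _ (smoothM oU (fs i) IH)) => x _.
by rewrite big_cons.
Qed.

Lemma smooth_det (R : realType) (V : normedModType R) n (U : set V)
    (A : V -> 'M[R]_n) : open U ->
  (forall i j, smooth U (fun x => A x i j)) -> smooth U (fun x => \det (A x)).
Proof.
move=> oU As; apply: smooth_sum => // s; apply: smoothM => //; first exact: smooth_cst.
by apply: smooth_prod => // i; exact: As.
Qed.

Lemma poly_nonroot (R : realType) (p : {poly R}) (e : R) : p != 0 -> 0 < e ->
  exists t, [/\ 0 < t, t < e & p.[t] != 0].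
Proof.
move=> p0 e0; apply: contrapT => /forallNP h.
(* These are [size p] distinct points, one more than p can have roots; starting the denominators at
   2 keeps them strictly below e. *)
pose s := [seq e / i.+2%:R | i <- iota 0 (size p)].
have us : uniq s.
  rewrite map_inj_uniq ?iota_uniq // => i j /(mulfI (lt0r_neq0 e0)) /invr_inj /eqP.
  by rewrite eqr_nat => /eqP [].
have rs : all (root p) s.
  apply/allP => t /mapP[i _ ->]; apply/negPn/negP => ri; apply: (h (e / i.+2%:R)).
  split => //; first by rewrite divr_gt0.
  by rewrite ltr_pdivrMr // ltr_pMr // ltr1n.
by have := max_poly_roots p0 rs us; rewrite size_map size_iota ltnn.
Qed.

Lemma det_affine_poly (R : realType) n (A B : 'M[R]_n) :
  exists p : {poly R}, forall t, p.[t] = \det (A + t *: B).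
Proof.
exists (\det (map_mx polyC A + 'X *: map_mx polyC B)) => t.
rewrite -[LHS]/(horner_eval t _) -det_map_mx; congr (\det _).
by apply/matrixP => i j; rewrite !mxE -[LHS]/(((A i j)%:P + 'X * (B i j)%:P).[t]) !hornerE.
Qed.

(** T lets the curve skip bad parameters, such as the zeros of a determinant; only small t > 0 are
    tested because t = 0 itself may be bad. *)
Lemma closure_curve (R : realType) (V : normedModType R) (A : set V)
    (T : set R) (c : R^o -> V) :
  {for 0, continuous c} -> (forall e : R, 0 < e -> exists t, [/\ 0 < t, t < e & T t]) ->
  (\forall t \near (0 : R^o), 0 < t -> T t -> A (c t)) -> closure A (c 0).
Proof.
move=> cc Ts TA B nB.
have : \forall t \near (0 : R^o), (0 < t -> T t -> A (c t)) /\ B (c t).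
  by apply: filterS2 TA (cc B nB) => t; split.
move=> /nbhs_ballP[e /= e0 he]; have [t [t0 te Tt]] := Ts e e0.
have [] := he t; last by move=> h1 h2; exists (c t); split => //; exact: h1.
by rewrite /ball /= sub0r normrN gtr0_norm.
Qed.

(** * Independence along a fibre of fixed q *)

Section Independence.
Context {R : realType} {k l : nat} (J : 'I_(k + l) -> R).
Hypothesis J_sqr : forall i j, i != j -> J i ^+ 2 != J j ^+ 2.
Local Notation vec := 'rV[R]_(k + l).
Variables (o0 o1 : 'I_(k + l)).
Hypothesis o01 : o0 != o1.
Implicit Types (q P x y : vec) (i j h : 'I_(k + l)).

Lemma moment_row_affine q P P' (a b : R) i :
  moment_row J q (P + a *: (P' - P) + b *: q) i =
  moment_row J q P i + a *: (moment_row J q P' i - moment_row J q P i).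
Proof. by apply/rowP => j; rewrite !mxE /moment !mxE; ring. Qed.

Lemma rotation_affine q P P' (a b : R) i x :
  rotation J q (P + a *: (P' - P) + b *: q) i x =
  rotation J q P i x + a *: (rotation J q P' i x - rotation J q P i x).
Proof.
rewrite /rotation moment_row_affine !dotE; apply/rowP => j; rewrite !mxE; ring.
Qed.

(* Apart from the rows [o0] and [o1], these are the momentum components of the
   differentials of the integrals along the fibre over q. The row [o0] accounts
   for the vectors proportional to q; all rows but [o1] are orthogonal to q. *)
Definition fibre_mx q P : 'M[R]_(k + l) := \matrix_(i, j)
  if i == o0 then q 0 j else if i == o1 then tauv q 0 j
  else rotation J q P i q 0 j.

Lemma row_fibre0 q P : row o0 (fibre_mx q P) = q.
Proof. by apply/rowP => j; rewrite !mxE eqxx. Qed.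

Lemma row_fibre1 q P : row o1 (fibre_mx q P) = tauv q.
Proof. by apply/rowP => j; rewrite mxE mxE eq_sym (negbTE o01) eqxx. Qed.

Lemma row_fibre q P i : i != o0 -> i != o1 ->
  row i (fibre_mx q P) = rotation J q P i q.
Proof. by move=> i0 i1; apply/rowP => j; rewrite mxE mxE (negbTE i0) (negbTE i1). Qed.

Lemma fibre_mx_affine q P P' (a b : R) :
  fibre_mx q (P + a *: (P' - P) + b *: q) =
  fibre_mx q P + a *: (fibre_mx q P' - fibre_mx q P).
Proof.
have e m n (A B : 'M[R]_(m, n)) r s :
  (A + a *: (B - A)) r s = A r s + a * (B r s - A r s) by rewrite !mxE.
have f P0 i j : fibre_mx q P0 i j = if i == o0 then q 0 j
  else if i == o1 then tauv q 0 j else rotation J q P0 i q 0 j by rewrite mxE.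
apply/matrixP => i j; rewrite e !f.
case: ifP => _; first by rewrite subrr mulr0 addr0.
case: ifP => _; first by rewrite subrr mulr0 addr0.
by rewrite rotation_affine e.
Qed.

Lemma dot_suml (I : Type) (r : seq I) (Q : pred I) (f : I -> vec) y :
  pseudo_dot (\sum_(i <- r | Q i) f i) y = \sum_(i <- r | Q i) pseudo_dot (f i) y.
Proof.
by elim/big_rec2: _ => [|i a b _ <-]; [exact: dot0l|rewrite dotDl].
Qed.

(** The row [o0] equals q and absorbs the right-hand side, so the relation puts c - a e_o0 in the
    left kernel of an invertible matrix. *)
Lemma fibre_mx_free q P (c : vec) (a : R) : pseudo_dot q q = 0 ->
  \det (fibre_mx q P) != 0 -> c 0 o0 = 0 -> c 0 o1 = 0 ->
  \sum_i c 0 i *: rotation J q P i q = a *: q -> c = 0.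
Proof.
move=> qq d0 c0 c1 e.
have H : fibre_mx q P \in unitmx by rewrite unitmxE unitfE.
have z : (c - a *: delta_mx 0 o0) *m fibre_mx q P = 0.
  rewrite mulmxBl -scalemxAl -rowE row_fibre0 -e mulmx_sum_row -sumrB.
  apply: big1 => i _.
  have [->|i0] := eqVneq i o0; first by rewrite c0 !scale0r subrr.
  have [->|i1] := eqVneq i o1; first by rewrite c1 !scale0r subrr.
  by rewrite row_fibre // subrr.
have {}z : c - a *: delta_mx 0 o0 = 0 by rewrite -[LHS](mulmxK H) z mul0mx.
have a0 : a = 0.
  have /matrixP/(_ 0 o0) := z; rewrite !mxE c0 !eqxx mulr1 sub0r.
  by move/eqP; rewrite oppr_eq0 => /eqP.
by move: z; rewrite a0 scale0r subr0.
Qed.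

(** By symmetry of the [moment_row] entries both halves of [rotation] share one factor per pair (i,
    j), so the sum decouples as soon as that factor is a product. *)
Lemma rotation_sum q P (c : vec) j :
  (\sum_i c 0 i *: rotation J q P i q) 0 j =
  \sum_i tau R i * (tau R i * c 0 i - tau R j * c 0 j) * q 0 i * moment_row J q P j 0 i.
Proof.
rewrite summxE.
have e i : (c 0 i *: rotation J q P i q) 0 j = c 0 i * q 0 i * moment_row J q P i 0 j
   - (if i == j then c 0 j * (tau R j * pseudo_dot (moment_row J q P j) q) else 0).
  rewrite ![in LHS]mxE [in RHS]mxE eqxx /= (eq_sym j i).
  by have [->|ij] := eqVneq i j; rewrite ?mulr1 ?mulr0; ring.
rewrite (eq_bigr _ (fun i _ => e i)) big_split /= sumrN -big_mkcond big_pred1_eq.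
rewrite /pseudo_dot !mulr_sumr -sumrB; apply: eq_bigr => i _.
by rewrite (moment_row_sym J q P i j) -[X in X - _]mul1r -(tau_sq i); ring.
Qed.

Lemma fibre_mx_generic q P (z g : R) : pseudo_dot q q = 0 ->
  (forall i, q 0 i != 0) -> (forall i, J i ^+ 2 != z) -> g != 0 ->
  \sum_i tau R i * q 0 i ^+ 2 / (J i ^+ 2 - z) != 0 ->
  (forall i, P 0 i = g * q 0 i / (J i ^+ 2 - z)) ->
  \det (fibre_mx q P) != 0.
Proof.
move=> qq q0 az g0; set G := \sum_i _ => G0 PE.
have {}az i : J i ^+ 2 - z != 0 by rewrite subr_eq0.
apply/det0P => -[v v0 vH]; case/negP: v0; apply/eqP.
pose c : vec := \row_i if (i == o0) || (i == o1) then 0 else v 0 i.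
have c0 : c 0 o0 = 0 by rewrite mxE eqxx.
have c1 : c 0 o1 = 0 by rewrite mxE eqxx orbT.
pose V := \sum_i c 0 i *: rotation J q P i q.
have VE : v 0 o0 *: q + v 0 o1 *: tauv q + V = 0.
  rewrite -vH mulmx_sum_row (bigD1 o0) //= (bigD1 o1) //=; last by rewrite eq_sym.
  rewrite row_fibre0 row_fibre1 addrA; congr (_ + _).
  rewrite /V (bigD1 o0) //= (bigD1 o1) //=; last by rewrite eq_sym.
  rewrite c0 c1 !scale0r !add0r; apply: eq_bigr => i /andP[i0 i1].
  by rewrite row_fibre // mxE (negbTE i0) (negbTE i1).
have Vq : pseudo_dot V q = 0.
  by rewrite dot_suml big1 // => i _; rewrite dotZl rotation_dotxx mulr0.
have qn0 : q != 0 by apply/eqP => /rowP/(_ o0) /eqP; rewrite mxE (negbTE (q0 o0)).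
have v1 : v 0 o1 = 0.
  have := congr1 (fun w : vec => pseudo_dot w q) VE; rewrite !dotE Vq qq dot0l mulr0 add0r addr0.
  rewrite dotC => /eqP; rewrite mulf_eq0.
  by rewrite (gt_eqF (dot_tauv_gt0 qn0)) orbF => /eqP.
have {VE}VE : V = - v 0 o0 *: q.
  apply/eqP; rewrite scaleNr -addr_eq0 addrC; apply/eqP.
  by rewrite -[RHS]VE v1 scale0r addr0.
pose H0 := \sum_i tau R i * (tau R i * c 0 i) * q 0 i ^+ 2 / (J i ^+ 2 - z).
(* Here m_ij / (a_i - a_j) = g q_i q_j / ((a_i - z) (a_j - z)) for i != j. The term i = j may be
   included in both sums, since its factor tau_i c_i - tau_j c_j is zero. *)
have key j : g * (H0 - tau R j * c 0 j * G) = - v 0 o0 * (J j ^+ 2 - z).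
  have := congr1 (fun w : vec => w 0 j) VE; rewrite rotation_sum [RHS]mxE.
  move=> h; apply: (mulIf (q0 j)).
  rewrite [RHS]mulrAC -h /H0 /G [in LHS]mulr_sumr -sumrB mulr_sumr !mulr_suml.
  apply: eq_bigr => i _; rewrite [moment_row _ _ _ _ _ _]mxE /moment !PE.
  have [->|ij] := eqVneq i j; first by ring.
  by field; rewrite !az subr_eq0 eq_sym J_sqr // eq_sym.
(* At [o0] and [o1] c vanishes, so the left side of [key] is g H0 in both cases, whereas a_j - z
   takes two different values on the right. *)
have s0 : v 0 o0 = 0.
  have := key o1; rewrite c1 mulr0 mul0r subr0.
  have := key o0; rewrite c0 mulr0 mul0r subr0 => -> /eqP.
  rewrite -subr_eq0 -mulrBr mulf_eq0 oppr_eq0 => /orP[/eqP //|].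
  by rewrite opprB addrA subrK subr_eq0 (negbTE (J_sqr o01)).
have H00 : H0 = 0.
  have /eqP := key o0; rewrite s0 oppr0 mul0r mulf_eq0 (negbTE g0) c0.
  by rewrite mulr0 mul0r subr0 => /eqP.
have cz j : c 0 j = 0.
  have /eqP := key j; rewrite s0 oppr0 mul0r mulf_eq0 (negbTE g0) H00 sub0r.
  rewrite oppr_eq0 /= mulf_eq0 (negbTE G0) orbF => /eqP h.
  by rewrite -[LHS]mul1r -(tau_sq j) -mulrA h mulr0.
apply/rowP => j; rewrite [RHS]mxE.
have [->//|j0] := eqVneq j o0; have [->//|j1] := eqVneq j o1.
by have := cz j; rewrite mxE (negbTE j0) (negbTE j1).
Qed.

(** W is the numerator of the sum over the common denominator N. At z = a_o0 only the term i = [o0]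
    of W survives, so W != 0, and any z outside the roots of W N is suitable. *)
Lemma generic_pole q : (forall i, q 0 i != 0) ->
  exists z, (forall i, J i ^+ 2 != z) /\
    \sum_i tau R i * q 0 i ^+ 2 / (J i ^+ 2 - z) != 0.
Proof.
move=> q0.
pose W : {poly R} := \sum_i (tau R i * q 0 i ^+ 2) *:
   \prod_(j | j != i) ((J j ^+ 2)%:P - 'X).
pose N : {poly R} := \prod_j ((J j ^+ 2)%:P - 'X).
have NE z : N.[z] = \prod_j (J j ^+ 2 - z).
  by rewrite horner_prod; apply: eq_bigr => j _; rewrite !hornerE.
have WE z : W.[z] = \sum_i tau R i * q 0 i ^+ 2 * \prod_(j | j != i) (J j ^+ 2 - z).
  rewrite horner_sum; apply: eq_bigr => i _; rewrite hornerZ horner_prod.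
  by congr (_ * _); apply: eq_bigr => j _; rewrite !hornerE.
have W0 : W != 0.
  apply/eqP => /(congr1 (horner^~ (J o0 ^+ 2))); rewrite horner0 WE.
  rewrite (bigD1 o0) //= [X in _ + X]big1 ?addr0 => [/eqP|i i0]; last first.
    by rewrite (bigD1 o0) 1?eq_sym //= subrr mul0r mulr0.
  apply/negP; rewrite !mulf_neq0 //.
  - apply/eqP => t0; have := tau_sq (R := R) o0; rewrite t0 mul0r => /eqP.
    by rewrite eq_sym oner_eq0.
  - by apply/prodf_neq0 => j jo; rewrite subr_eq0 J_sqr.
have N0 : N != 0.
  apply/prodf_neq0 => j _; rewrite subr_eq0; apply/eqP => /(congr1 (fun p : {poly R} => size p)).
  by rewrite size_polyX size_polyC; case: (_ == _).
have [z [_ _]] := poly_nonroot (mulf_neq0 W0 N0) ltr01.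
rewrite hornerM mulf_eq0 negb_or => /andP[Wz]; rewrite NE => /prodf_neq0 Nz.
have az i : J i ^+ 2 - z != 0 by exact: Nz.
exists z; split; first by move=> i; rewrite -subr_eq0.
move: Wz; apply: contra => /eqP G0; rewrite WE.
have : N.[z] * \sum_i tau R i * q 0 i ^+ 2 / (J i ^+ 2 - z) = 0 by rewrite G0 mulr0.
rewrite mulr_sumr => e; rewrite -[X in _ == X]e; apply/eqP/eq_bigr => i _.
by rewrite NE [in RHS](bigD1 i) //=; field.
Qed.

End Independence.

(** * Density of the regular points in [M_kappa] *)

Section FunctionalIndependence.
Context {R : realType} {k l : nat} (J : 'I_(k + l) -> R) (kappa : R).
Hypotheses (J_neq0 : forall i, J i != 0)
  (J_sqr : forall i j, i != j -> J i ^+ 2 != J j ^+ 2)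
  (kappa_gt0 : 0 < kappa).
Variables (o0 o1 : 'I_(k + l)).
Hypothesis o01 : o0 != o1.
Local Notation vec := 'rV[R]_(k + l).
Local Notation pt := 'rV[R]_(k + l + (k + l)).
Local Notation M := (M_kappa J kappa).
Local Notation mom := (mom J).
Implicit Types (p v x : pt).

Definition regular_set : set pt :=
  [set x | setT x /\ \det (fibre_mx J o0 o1 (qpart x) (mom x)) != 0].

Lemma open_regular_set : open regular_set.
Proof.
have oT := @openT pt; apply: smooth_open_neq0 => //; apply: smooth_det => // i j.
have sq := smooth_row_coord j oT (smooth_qpart oT).
apply: (@smooth_ext _ _ _ _ (fun x => if i == o0 then qpart x 0 j else
  if i == o1 then tau R j * qpart x 0 j else xrot J i x (qpart x) 0 j)) => //.
  by move=> x _; rewrite [RHS]mxE [tauv _ _ _]mxE xrotE.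
case: (i == o0) => //; case: (i == o1).
  by apply: smoothM => //; exact: smooth_cst.
by apply: smooth_row_coord => //; apply: smooth_xrot => //; exact: smooth_qpart.
Qed.

(** Tangent vectors with zero q part already suffice: their momentum parts fill the orthogonal
    complement of q and J^-1 Q, so V lies in the plane of these two. As V is orthogonal to q, its
    J^-1 Q component vanishes. *)
Lemma regular_independent m (f : 'I_m -> 'I_(k + l)) p (c : 'I_m -> R) :
  injective f -> (forall i, f i != o0) -> (forall i, f i != o1) ->
  M p -> regular_set p ->
  (forall v, tangent M p v ->
     \sum_i c i * mdiff M (heis_integral J (f i)) p v = 0) ->
  forall i, c i = 0.
Proof.
move=> fi f0 f1 Mp [_ d0] cd; have [qq QQ] := M_light Mp.
have j0 := M_qJVQ_neq0 Mp.
set q := qpart p in qq j0 d0; set Q := Qpart p in QQ j0.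
pose C : vec := \sum_i c i *: delta_mx 0 (f i).
have Cf i : C 0 (f i) = c i.
  rewrite summxE (bigD1 i) //= big1 ?addr0 => [|j ji]; rewrite !mxE eqxx /=.
    by rewrite eqxx mulr1.
  by rewrite (inj_eq fi) eq_sym (negbTE ji) mulr0.
have C0 o : (forall i, f i != o) -> C 0 o = 0.
  move=> fo; rewrite summxE big1 // => j _.
  by rewrite !mxE eqxx eq_sym (negbTE (fo j)) mulr0.
pose V : vec := \sum_i c i *: rotation J q (mom p) (f i) q.
have VE : \sum_i C 0 i *: rotation J q (mom p) i q = V.
  pose r i := rotation J q (mom p) i q.
  transitivity (C *m \matrix_i r i).
    by rewrite mulmx_sum_row; apply: eq_bigr => i _; rewrite rowK.
  by rewrite mulmx_suml; apply: eq_bigr => i _; rewrite -scalemxAl -rowE rowK.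
have Vq : pseudo_dot V q = 0.
  by rewrite dot_suml big1 // => i _; rewrite dotZl rotation_dotxx mulr0.
have [a [b Vab]] : exists a b, V = a *: q + b *: Jpow J (-1) Q.
  apply: dot_span => // y qy Qy.
  have ty : tangent M p (row_mx 0 (Jpow J (-1) y)).
    apply/tangentP => //; split; rewrite !part_rowE ?dot0l ?dot0r //.
      by rewrite -Jpow_dot.
    by rewrite (JpowVK J_neq0) add0r.
  have := cd _ ty; rewrite (eq_bigr (fun i =>
    2 * (c i * pseudo_dot (rotation J q (mom p) (f i) q) y))).
    rewrite -mulr_sumr => /eqP; rewrite mulf_eq0 pnatr_eq0 /= => /eqP h.
    by rewrite dot_suml -[RHS]h; apply: eq_bigr => i _; rewrite dotZl.
  move=> i _; rewrite mdiff_integral // derive_integral !part_rowE (JpowVK J_neq0).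
  by rewrite dot0r subr0 xrotE; ring.
have b0 : b = 0.
  move: Vq; rewrite Vab !dotE qq mulr0 add0r dotC => /eqP.
  by rewrite mulf_eq0 (negbTE j0) orbF => /eqP.
move: Vab; rewrite b0 scale0r addr0 -VE => Vab i.
rewrite -Cf (fibre_mx_free (a := a) qq d0 (C0 _ f0) (C0 _ f1) Vab).
by rewrite mxE.
Qed.

Lemma near0_neq0 (U : set R^o) (f : R^o -> R) : open U -> U 0 -> smooth U f ->
  f 0 != 0 -> \forall t \near (0 : R^o), f t != 0.
Proof. by move=> oU U0 sf f0; apply: (cvgr_neq0 _ (smooth_continuous sf U0) f0). Qed.

(** Move q along (1, ..., 1), return to the cone along [tauv q] and rescale Q. As [tauv q] vanishes
    in the same coordinates as q, a zero coordinate becomes exactly t; the others stay nonzero by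
    continuity. *)
Lemma dense_coord_neq0 : M `<=` closure (M `&` [set x | forall i, qpart x 0 i != 0]).
Proof.
move=> p Mp; have [qq QQ] := M_light Mp.
have s0 := M_neq0 kappa_gt0 Mp; have j0 := M_qJVQ_neq0 Mp.
have q2 := dot_tauv_gt0 (M_q_neq0 kappa_gt0 Mp).
have [_ sk] := Mp; rewrite /mom in s0.
set q := qpart p in qq s0 j0 q2 sk; set Q := Qpart p in QQ s0 j0 sk.
set s := pseudo_dot q (Jpow J 1 Q) in s0 sk.
pose one : vec := const_mx 1.
pose d (t : R^o) : R := pseudo_dot (q + t *: one) (tauv q).
pose qt (t : R^o) : vec := q + t *: one
  - (pseudo_dot (q + t *: one) (q + t *: one) / (2 * d t)) *: tauv q.
pose b (t : R^o) : R := pseudo_dot (qt t) (Jpow J 1 Q).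
pose c (t : R^o) : pt := row_mx (qt t) ((s / b t) *: Q).
have st (U : set R^o) := smooth_param U.
have sl (U : set R^o) : open U -> smooth U (fun t : R^o => q + t *: one).
  by move=> oU; apply: smoothD => //; [exact: smooth_cst|exact: smoothZl].
pose U1 : set R^o := [set t | setT t /\ d t != 0].
have oU1 : open U1.
  apply: smooth_open_neq0; first exact: openT.
  by apply: (smooth_dot openT); [exact/sl/openT|exact: smooth_cst].
have U10 : U1 0 by split => //; rewrite /d scale0r addr0 lt0r_neq0.
have sqt : smooth U1 qt.
  apply: smoothD => //; first exact: sl.
  apply: smooth_rowN => //; apply: smoothZl => //; apply: smoothM => //.
    by apply: smooth_dot => //; exact: sl.
  apply: smoothV => //; first by move=> t [_ ?]; apply: mulf_neq0; rewrite ?pnatr_eq0.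
  apply: smoothM => //; first exact: smooth_cst.
  by apply: smooth_dot => //; [exact: sl|exact: smooth_cst].
have sb : smooth U1 b by apply: smooth_dot => //; exact: smooth_cst.
pose U2 : set R^o := [set t | U1 t /\ b t != 0].
have oU2 : open U2 by exact: smooth_open_neq0.
have qt0 : qt 0 = q by rewrite /qt !scale0r !addr0 qq mul0r scale0r subr0.
have b0 : b 0 = s by rewrite /b qt0.
have U20 : U2 0 by split => //; rewrite b0.
have U21 : U2 `<=` U1 by move=> t [].
have sc : smooth U2 c.
  apply: smooth_row_mx => //; first exact: smooth_sub sqt.
  apply: smoothZl => //; apply: smoothM => //; first exact: smooth_cst.
  by apply: smoothV => //; [move=> t []|exact: smooth_sub sb].
have c0 : c 0 = p by rewrite /c qt0 b0 divff // scale1r /q /Q /qpart /Qpart hsubmxK.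
rewrite -c0; apply: (@closure_curve _ _ _ setT); first exact: smooth_continuous sc U20.
  by move=> e e0; exists (e / 2); rewrite divr_gt0 // ltr_pdivrMr // ltr_pMr // ltr1n.
have nU : \forall t \near (0 : R^o), U2 t by exact: open_nbhs_nbhs.
have nj : \forall t \near (0 : R^o), pseudo_dot (qt t) (Jpow J (-1) Q) != 0.
  apply: (near0_neq0 (f := fun t => pseudo_dot (qt t) (Jpow J (-1) Q)) oU1) => //;
    last by rewrite qt0.
  by apply: smooth_dot => //; exact: smooth_cst.
have nq : \forall t \near (0 : R^o), forall i, 0 < t -> qt t 0 i != 0.
  apply: (@filter_forall R^o 'I_(k + l)
    (fun i t => 0 < t -> qt t 0 i != 0) (nbhs (0 : R^o)) _) => i.
  have [qi0|qi0] := eqVneq (q 0 i) 0.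
    have e (x : vec) (a u : R) : (x + u *: one - a *: tauv x) 0 i =
      x 0 i + u - a * (tau R i * x 0 i) by rewrite !mxE mulr1.
    apply: filterE => t t0; rewrite /qt e qi0 !mulr0 subr0 add0r.
    exact: lt0r_neq0.
  have : \forall t \near (0 : R^o), qt t 0 i != 0.
    apply: (near0_neq0 (f := fun t => qt t 0 i) oU1) => //; last by rewrite qt0.
    exact: smooth_row_coord.
  by apply: filterS.
near=> t => t0 _.
have [[_ dt] bt] : U2 t by near: t.
have jt : pseudo_dot (qt t) (Jpow J (-1) Q) != 0 by near: t.
have qit : forall i, 0 < t -> qt t 0 i != 0 by near: t.
split; last by move=> i; rewrite part_rowE; exact: qit.
split; [split; [split|]|]; rewrite /light_cone /= !part_rowE.
- rewrite {1 2}/qt !dotBl !dotBr !dotZl !dotZr dot_tauv qq.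
  by rewrite (dotC (tauv q)) -/(d t); field.
- by rewrite dotZl dotZr QQ !mulr0.
- by rewrite JpowZ dotZr; do ?apply: mulf_neq0 => //; rewrite invr_eq0.
- by rewrite JpowZ dotZr -/(b t) divfK.
Unshelve. all: by end_near. Qed.

Lemma dense_regular_fibre :
  M `&` [set x | forall i, qpart x 0 i != 0] `<=` closure (M `&` regular_set).
Proof.
move=> p [Mp q0]; have [qq QQ] := M_light Mp.
have s0 := M_neq0 kappa_gt0 Mp; have j0 := M_qJVQ_neq0 Mp; have [_ sk] := Mp.
rewrite /= in q0.
set q := qpart p in qq s0 j0 q0 sk; set Q := Qpart p in QQ j0 sk.
set P := mom p in s0.
have QE : Q = Jpow J (-1) P by exact: Qpart_mom.
set s := pseudo_dot q P in s0.
have [z [az G0]] := generic_pole J_sqr o0 q0.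
set G := \sum_i _ in G0.
(* The factor s / G gives <q, P'> = s, so <q, P> = s on the whole segment from P to P', also after
   shifts along the light-like q. *)
pose P' : vec := \row_i (s / G * q 0 i / (J i ^+ 2 - z)).
have d' : \det (fibre_mx J o0 o1 q P') != 0.
  apply: (@fibre_mx_generic _ _ _ J J_sqr o0 o1 o01 q P' z (s / G)) => //.
    by rewrite mulf_neq0 ?invr_eq0.
  by move=> i; rewrite mxE.
have qP' : pseudo_dot q P' = s.
  rewrite -[RHS](divfK G0) [in RHS]/G mulr_sumr; apply: eq_bigr => i _.
  by rewrite [P' _ _]mxE; ring.
pose Pt (t : R^o) : vec := P + t *: (P' - P).
pose B (x y : vec) : R := pseudo_dot (Jpow J (-1) x) (Jpow J (-1) y).
pose a := B q q.
pose b (t : R^o) : R := B q (Pt t).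
pose e (t : R^o) : R := B (Pt t) (Pt t).
(* Adding r q to Pt must cancel e, the failure of the cone condition for Q. At t = 0, e vanishes and
   b = <J^-1 q, Q> is nonzero by [P0star], so the discriminant is positive nearby. The root is
   written without division by a, which may be 0. *)
pose h (t : R^o) : R := Num.sqrt (1 - a * e t / b t ^+ 2).
(* The root of a r^2 + 2 b r + e = 0 that vanishes with e *)
pose r (t : R^o) : R := - e t / (b t * (1 + h t)).
pose c (t : R^o) : pt := row_mx q (Jpow J (-1) (Pt t)) + r t *: row_mx 0 (Jpow J (-1) q).
have sPt : smooth setT Pt.
  apply: (smoothD openT); first exact: smooth_cst.
  by apply: (smoothZl _ openT); exact: smooth_param.
have sJ := smooth_Jpow J (-1) openT sPt.
have sb : smooth setT b by apply: (smooth_dot openT) => //; exact: smooth_cst.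
have se : smooth setT e by exact: (smooth_dot openT).
have Pt0 : Pt 0 = P by rewrite /Pt scale0r addr0.
have e0 : e 0 = 0 by rewrite /e Pt0 /B -QE.
have b0 : b 0 != 0 by rewrite /b Pt0 /B -QE Jpow_dot.
have bc := smooth_continuous sb (I : setT (0 : R^o)).
have ec := smooth_continuous se (I : setT (0 : R^o)).
have kc : {for (0 : R^o), continuous (fun t : R^o => 1 - a * e t / b t ^+ 2 : R)}.
  apply: cvgB; first exact: cvg_cst.
  apply: cvgM; first by apply: cvgM => //; exact: cvg_cst.
  by apply: cvgV; [rewrite expf_neq0|apply: cvgM].
have k0 : 1 - a * e 0 / b 0 ^+ 2 = 1 by rewrite e0 mulr0 mul0r subr0.
have hc : {for (0 : R^o), continuous h}.
  by apply: continuous_comp => //; exact: sqrt_continuous.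
have h0 : h 0 = 1 by rewrite /h k0 sqrtr1.
have dc : {for (0 : R^o), continuous (fun t : R^o => b t * (1 + h t) : R)}.
  by apply: cvgM => //; apply: cvgD => //; exact: cvg_cst.
have d0 : b 0 * (1 + h 0) != 0 by rewrite h0 mulf_neq0 // pnatr_eq0.
have rc : {for (0 : R^o), continuous r}.
  by apply: cvgM; [exact: cvgN|exact: cvgV].
have r0 : r 0 = 0 by rewrite /r e0 oppr0 mul0r.
have sr : smooth setT (fun t : R^o => row_mx q (Jpow J (-1) (Pt t))).
  by apply: (smooth_row_mx openT) => //; exact: smooth_cst.
have cc : {for (0 : R^o), continuous c}.
  apply: cvgD; first exact: (smooth_continuous sr (I : setT (0 : R^o))).
  by apply: cvgZ => //; exact: cvg_cst.
have c0 : c 0 = p.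
  by rewrite /c r0 scale0r addr0 Pt0 -QE /q /Q /qpart /Qpart hsubmxK.
have qc t : qpart (c t) = q.
  by rewrite /c /qpart linearD linearZ /= !row_mxKl scaler0 addr0.
have Qc t : Qpart (c t) = Jpow J (-1) (Pt t + r t *: q).
  by rewrite /c /Qpart linearD linearZ /= !row_mxKr !JpowE.
have Pc t : mom (c t) = P + t *: (P' - P) + r t *: q.
  by rewrite /mom Qc (JpowVK J_neq0).
have [W WE] := det_affine_poly (fibre_mx J o0 o1 q P)
   (fibre_mx J o0 o1 q P' - fibre_mx J o0 o1 q P).
have W0 : W != 0.
  apply/eqP => W0; move: d'; have := WE 1.
  by rewrite W0 horner0 scale1r addrC subrK => <-; rewrite eqxx.
rewrite -c0; apply: (@closure_curve _ _ _ [set t | W.[t] != 0]) => //.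
  by move=> ep ep0; exact: poly_nonroot.
have nb : \forall t \near (0 : R^o), b t != 0 by exact: (cvgr_neq0 _ bc b0).
have nd : \forall t \near (0 : R^o), b t * (1 + h t) != 0 by exact: (cvgr_neq0 _ dc d0).
have nk : \forall t \near (0 : R^o), 0 < 1 - a * e t / b t ^+ 2.
  by apply: (cvgr_gt _ kc); rewrite k0.
have nj : \forall t \near (0 : R^o), b t + a * r t != 0.
  have jc : {for (0 : R^o), continuous (fun t : R^o => b t + a * r t : R)}.
    by apply: cvgD => //; apply: cvgM => //; exact: cvg_cst.
  by apply: (cvgr_neq0 _ jc); rewrite r0 mulr0 addr0.
near=> t => t0 Wt.
have bt : b t != 0 by near: t.
have dt : b t * (1 + h t) != 0 by near: t.
have kt : 0 < 1 - a * e t / b t ^+ 2 by near: t.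
have jt : b t + a * r t != 0 by near: t.
split; last first.
  by split => //; rewrite qc Pc fibre_mx_affine -WE.
have qPt : pseudo_dot q (Pt t + r t *: q) = s.
  by rewrite /Pt !dotE qP' qq -/s; ring.
split; [split; [split|]|]; rewrite /light_cone /= ?qc ?Qc //.
- have h2 : h t ^+ 2 = 1 - a * e t / b t ^+ 2 by rewrite sqr_sqrtr // ltW.
  have ex (x : vec) (u : R) : pseudo_dot (Jpow J (-1) (x + u *: q))
      (Jpow J (-1) (x + u *: q)) = B x x + 2 * u * B q x + u ^+ 2 * B q q.
    by rewrite /B !JpowE !dotE (dotC (Jpow J (-1) x) (Jpow J (-1) q)); ring.
  rewrite ex -/(b t) -/(e t) -/a.
  have h1 : 1 + h t != 0 by move: dt; rewrite mulf_eq0 negb_or => /andP[].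
  have eE : a * e t = b t ^+ 2 * (1 - h t ^+ 2) by rewrite h2; field.
  transitivity (e t * (a * e t - b t ^+ 2 * (1 - h t ^+ 2)) / (b t * (1 + h t)) ^+ 2).
    by rewrite /r; field; rewrite h1 bt.
  by rewrite eE subrr mulr0 mul0r.
- have ex (x : vec) (u : R) : pseudo_dot q (Jpow J (-1) (Jpow J (-1) (x + u *: q)))
      = B q x + B q q * u.
    by rewrite -Jpow_dot /B !JpowE !dotE; ring.
  by rewrite ex.
- by rewrite (JpowVK J_neq0) qPt.
Unshelve. all: by end_near. Qed.

(** The two approximations, first of q and then of P over a fixed q, combine because a closure is
    closed. *)
Lemma dense_regular : M `<=` closure (M `&` regular_set).
Proof.
move=> p /dense_coord_neq0 cp.
apply/closed_closure; move: p cp; exact: closure_subset dense_regular_fibre.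
Qed.

End FunctionalIndependence.

Theorem theorem3p3 (R : realType) (k l : nat) (J : 'I_(k + l) -> R) (kappa : R)
    (hk : (1 <= k)%N) (hl : (1 <= l)%N)
    (J_neq0 : forall i, J i != 0)
    (J_sqr : forall i j, i != j -> J i ^+ 2 != J j ^+ 2)
    (kappa_gt0 : 0 < kappa) :
  completely_integrable_contact (2 * (k + l) - 3)
    (M_kappa J kappa) (alpha J) (heis_dom J) (heis_Phi J).
Proof.
(* With n >= 2 there are two indices 0 and 1 to discard, and the truncated subtractions in 2n - 3 =
   2 (n - 2) + 1 are exact. *)
have n2 : (2 <= k + l)%N by exact: (leq_add hk hl).
pose o0 := Ordinal (ltnW n2); pose o1 := Ordinal n2.
have o01 : o0 != o1 by [].
have fP (i : 'I_(k + l - 2)) : (i.+2 < k + l)%N by case: i => i /=; lia.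
pose f i := Ordinal (fP i).
have f_inj : injective f by move=> i j [] /val_inj.
split.
- split; last exact: contact_form_alpha.
  by apply: embedded_M => //; lia.
- exact: contact_map_Phi.
exists (k + l - 2)%N; split; first by lia.
exists (fun i => heis_integral J (f i)), (reeb J), (fun i => ham_field J (f i)).
split.
- by move=> i; exact: smooth_on_integral.
- by split; [exact: is_reeb_reeb|move=> i; exact: contact_field_ham].
- by move=> i p Mp _; exact: heis_integral_Phi Mp.
- split; first by move=> i p Mp; exact: lie_reeb_integral Mp.
  by move=> i j p Mp; exact: jacobi_bracket_integral Mp.
- exists (regular_set J o0 o1); split.
  + exact: open_regular_set.
  + exact: dense_regular.
  + by move=> p Mp Up c; apply: regular_independent Mp Up.
Qed.
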